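(* Let $\mathcal{P}_1=(P_1,d\mu_1,d\sigma_1)$ and $\mathcal{P}_2=(P_2,d\mu_2,d\sigma_2)$ be systems and let $T\ge0$. Then the $\mu$-canonical distribution of temperature $T$ of the composite system $\mathcal{P}_1\times\mathcal{P}_2$ is the product $u_1\times u_2$, $(x,y)\mapsto u_1(x)u_2(y)$, where $u_1$ and $u_2$ are the $\mu$-canonical distributions of temperature $T$ of $\mathcal{P}_1$ and $\mathcal{P}_2$ respectively.
   Context: An $n$-dimensional system is a triple $\mathcal{P}=(P,d\mu,d\sigma)$ where $P$ is a simple polytope in an $n$-dimensional real affine space $V$ (a compact subset with non-empty interior that is a finite intersection of closed half spaces, such that every vertex is the intersection of exactly $n$ facets), $d\mu$ is the restriction to $P$ of a translation-invariant measure on $V$ that is positive and finite on bounded non-empty open sets (i.e. a positive multiple of Lebesgue measure), and $d\sigma$ is a measure on the boundary $\partial P$ whose restriction to each facet is a positive multiple of the Lebesgue measure of the affine hyperplane spanned by that facet. For $p\ge1$, $\mathcal{M}^p(P)$ is the set of lower semicontinuous functions $u:P\to(0,\infty]$ that are log-convex ($u((1-t)x+ty)\le u(x)^{1-t}u(y)^t$ for $x,y\in P$, $t\in[0,1]$) and satisfy $\int_P u\,d\mu=\int_P d\mu$ and $\int_P u^p\,d\mu<\infty$. For $u\in\mathcal{M}^1(P)$: entropy $S_{\mathcal{P}}(u):=-\frac{1}{\int_Pd\mu}\int_P u\log u\,d\mu\in[-\infty,0]$; internal $\mu$-energy $U_{\mathcal{P}}(u):=\frac{1}{\int_Pd\mu}\int_{\partial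 P}u\,d\sigma\in(0,\infty]$; and for $T\in\mathbb{R}$, free $\mu$-energy $F_{\mathcal{P}}(T,u):=U_{\mathcal{P}}(u)-TS_{\mathcal{P}}(u)$ if $S_{\mathcal{P}}(u)>-\infty$, and $F_{\mathcal{P}}(T,u):=+\infty$ if $S_{\mathcal{P}}(u)=-\infty$. The $\mu$-canonical distribution of temperature $T>0$ is the unique minimizer $u^{\mathrm{can}}_T$ of $F_{\mathcal{P}}(T,\cdot)$ on $\mathcal{M}^1(P)$; for $T=0$, $u^{\mathrm{can}}_0$ is the unique minimizer of $U_{\mathcal{P}}$ on $\mathcal{M}^1(P)$ which has maximal entropy $S_{\mathcal{P}}$ among all minimizers of $U_{\mathcal{P}}$ (both exist and are unique). The composite system is $\mathcal{P}_1\times\mathcal{P}_2:=(P_1\times P_2,\ d\mu_1\times d\mu_2,\ d\sigma_1\times d\mu_2+d\mu_1\times d\sigma_2)$, where the last measure lives on $\partial(P_1\times P_2)=\partial P_1\times P_2\cup P_1\times\partial P_2$; it is again a system. *)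

(* Defs.v *)
From HB Require Import structures.
From mathcomp Require Import all_boot all_order all_algebra.
From mathcomp Require Import all_classical all_reals all_analysis.

Set Implicit Arguments.
Unset Strict Implicit.
Unset Printing Implicit Defensive.

Import Order.TTheory GRing.Theory Num.Theory.
Import numFieldNormedType.Exports.

Local Open Scope classical_set_scope.
Local Open Scope ring_scope.

(* The ambient (affine) space V of a system: a real normed vector space
   (the origin is an arbitrary choice of base point of the affine space)
   that also carries a sigma-algebra; the sigma-algebra is required to be
   the Borel one, and V is required to be n-dimensional, in [is_system]. *)
HB.structure Definition MeasNormedMod (R : realType) (d : measure_display) :=
  { V of Measurable d V & NormedModule R V }.

(* V1 * V2 (product norm, product sigma-algebra) is again such a space. *)
Section prod_instance.
Context (R : realType) (d1 d2 : measure_display)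
  (V1 : MeasNormedMod.type R d1) (V2 : MeasNormedMod.type R d2).
HB.instance Definition _ := Measurable.on (V1 * V2)%type.
End prod_instance.

Section polytopes.
Context (R : realType) (V : normedModType R).

Definition lin_functional (f : V -> R) : Prop :=
  forall (a : R) (x y : V), f (a *: x + y) = a * f x + f y.

Definition has_dim (n : nat) : Prop :=
  exists e : 'I_n -> V,
    forall v : V, exists! c : 'I_n -> R, v = \sum_(i < n) c i *: e i.

Definition hyperplane (f : V -> R) (c : R) : set V := [set x | f x = c].

Definition supporting (P : set V) (f : V -> R) (c : R) : Prop :=
  [/\ lin_functional f, (exists v, f v != 0) & forall x, P x -> f x <= c].

Definition polytope (P : set V) : Prop :=
  [/\ exists (m : nat) (f : 'I_m -> V -> R) (c : 'I_m -> R),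
        (forall i, lin_functional (f i) /\ exists v, f i v != 0) /\
        P = [set x | forall i, f i x <= c i],
      compact P &
      interior P !=set0].

(* F is a facet of P: F = P \cap H for a supporting hyperplane H of P,
   and F has non-empty interior relative to H (i.e. dim F = dim V - 1). *)
Definition facet (P : set V) (F : set V) : Prop :=
  exists (f : V -> R) (c : R),
    [/\ supporting P f c,
        F = P `&` hyperplane f c &
        exists2 x, F x & exists2 e : R, 0 < e & ball x e `&` hyperplane f c `<=` F].

Definition vertex (P : set V) (x : V) : Prop :=
  P x /\ exists (f : V -> R) (c : R),
    supporting P f c /\ P `&` hyperplane f c = [set x].

Definition simple_polytope (n : nat) (P : set V) : Prop :=
  polytope P /\
  forall x, vertex P x ->
    exists F : 'I_n -> set V,
      [/\ injective F,
          forall i, facet P (F i) /\ F i x &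
          forall G, facet P G -> G x -> exists i, G = F i].

Definition boundary (P : set V) : set V := closure P `\` interior P.

End polytopes.

Section systems.
Local Open Scope ereal_scope.
Context (R : realType) (d : measure_display) (V : MeasNormedMod.type R d).

Definition translate (v : V) (A : set V) : set V := [set (x + v)%R | x in A].

(* translation invariant, positive and finite on bounded non-empty open sets:
   i.e. a positive multiple of Lebesgue measure on V *)
Definition lebesgue_like (mu : {measure set V -> \bar R}) : Prop :=
  (forall (A : set V) (v : V), measurable A -> mu (translate v A) = mu A) /\
  (forall O : set V, open O -> bounded_set O -> O !=set0 -> 0 < mu O < +oo).

(* nu is a positive multiple of the Lebesgue measure of the affine
   hyperplane H = {f = c}: concentrated on H, invariant under translations
   parallel to H, positive and finite on bounded non-empty relatively open
   subsets of H. *)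
Definition hyperplane_lebesgue_like (f : V -> R) (c : R)
    (nu : {measure set V -> \bar R}) : Prop :=
  [/\ nu (~` hyperplane f c) = 0,
      (forall (A : set V) (v : V), measurable A -> f v = 0%R ->
          nu (translate v A) = nu A) &
      (forall O : set V, open O -> bounded_set O ->
          (O `&` hyperplane f c) !=set0 ->
          0 < nu (O `&` hyperplane f c) < +oo)].

Definition is_system (n : nat) (P : set V)
    (dmu dsigma : set V -> \bar R) : Prop :=
  [/\ has_dim V n,
      (@measurable d V) = <<s open >>,
      simple_polytope n P,
      (exists mu : {measure set V -> \bar R},
          lebesgue_like mu /\ dmu = (fun A => mu (A `&` P))) &
      (exists s : {measure set V -> \bar R},
        [/\ dsigma = s,
            s (~` boundary P) = 0 &
            forall (f : V -> R) (c : R),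
              facet P (P `&` hyperplane f c) -> supporting P f c ->
              exists nu : {measure set V -> \bar R},
                hyperplane_lebesgue_like f c nu /\
                forall A, measurable A -> A `<=` P `&` hyperplane f c ->
                  s A = nu A])].

Variables (P : set V) (dmu dsigma : set V -> \bar R).

Definition lsc_on (u : V -> \bar R) : Prop :=
  forall x, P x -> forall a : R, a%:E < u x ->
    exists2 e : R, (0 < e)%R &
      forall y, P y -> (`|y - x| < e)%R -> a%:E < u y.

Definition log_convex_on (u : V -> \bar R) : Prop :=
  forall (x y : V) (t : R), P x -> P y -> (0 <= t <= 1)%R ->
    u ((1 - t) *: x + t *: y)%R <= (u x `^ (1 - t)%R) * (u y `^ t).

Definition Mp (p : R) (u : V -> \bar R) : Prop :=
  [/\ forall x, P x -> 0 < u x,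
      lsc_on u,
      log_convex_on u,
      \int[dmu]_(x in P) u x = \int[dmu]_(x in P) 1 &
      \int[dmu]_(x in P) (u x `^ p) < +oo].

Definition xlogx (x : \bar R) : \bar R :=
  match x with
  | r%:E => (r * ln r)%:E
  | +oo => +oo
  | -oo => 0
  end.

Definition volume : \bar R := \int[dmu]_(x in P) 1.

Definition entropy (u : V -> \bar R) : \bar R :=
  - (((fine volume)^-1)%:E * \int[dmu]_(x in P) xlogx (u x)).

Definition internal_energy (u : V -> \bar R) : \bar R :=
  ((fine volume)^-1)%:E * \int[dsigma]_(x in boundary P) u x.

Definition free_energy (T : R) (u : V -> \bar R) : \bar R :=
  if entropy u == -oo then +oo
  else internal_energy u - T%:E * entropy u.

Definition canonical_distribution (T : R) (u : V -> \bar R) : Prop :=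
  Mp 1 u /\
  (((0 < T)%R /\ forall v, Mp 1 v -> free_energy T u <= free_energy T v) \/
   (T = 0%R /\
    (forall v, Mp 1 v -> internal_energy u <= internal_energy v) /\
    (forall v, Mp 1 v ->
       (forall w, Mp 1 w -> internal_energy v <= internal_energy w) ->
       entropy v <= entropy u))).

End systems.

Section composite.
Local Open Scope ereal_scope.
Context (R : realType) (d1 d2 : measure_display)
  (V1 : MeasNormedMod.type R d1) (V2 : MeasNormedMod.type R d2).

Definition comp_mu (dmu1 : set V1 -> \bar R) (dmu2 : set V2 -> \bar R)
  : set (V1 * V2)%type -> \bar R := dmu1 \x dmu2.

Definition comp_sigma (dmu1 dsigma1 : set V1 -> \bar R)
    (dmu2 dsigma2 : set V2 -> \bar R) : set (V1 * V2)%type -> \bar R :=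
  fun A => (dsigma1 \x dmu2) A + (dmu1 \x dsigma2) A.

Definition prod_fun (u1 : V1 -> \bar R) (u2 : V2 -> \bar R)
  : (V1 * V2)%type -> \bar R := fun z => u1 z.1 * u2 z.2.

End composite.

(* Main.v *)
Require Import Defs.
From HB Require Import structures.
From mathcomp Require Import all_boot all_order all_algebra.
From mathcomp Require Import all_classical all_reals all_analysis.
From mathcomp Require Import measurable_realfun ring lra.
Import Order.TTheory GRing.Theory Num.Theory.
Import numFieldNormedType.Exports.
Local Open Scope classical_set_scope.
Local Open Scope ring_scope.
Set Implicit Arguments.
Unset Strict Implicit.
Unset Printing Implicit Defensive.

(** For a distribution [v] on [P1 * P2] let [v1], [v2] be its marginals, the
averages of [v] over the other factor. By Tonelli, [U v = U1 v1 + U2 v2];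
entropy is subadditive, [S v <= S1 v1 + S2 v2], with equality when [v] is a
product; and the marginals are again log-convex (Young), lower semicontinuous
(Fatou) and normalised. So the free energy of [v] is at least
[F1 v1 + F2 v2 >= F1 u1 + F2 u2 = F (u1 * u2)]. At temperature 0, if [v] has
minimal energy then so have its marginals, because the minimal energies are
finite, and subadditivity again compares the entropies.

Tonelli and the finiteness at temperature 0 require the boundary measure to be
finite, which holds because finitely many facets cover the boundary.

Entropies are written as integrals of [x ln x - x + 1 >= 0], so that only
nonnegative functions are ever integrated. *)

(** Two obstacles shape the proof. Distributions, and with them energies and marginals, may take the
    value [+oo], so nothing may be subtracted at will: each identity or inequality is first
    rearranged into sums of nonnegative terms, then integrated, and only quantities known to be
    finite (multiples of the volume, minimal energies) are cancelled. Membership in [Mp] is a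
    condition at every point, not almost everywhere, so the marginals must be lower semicontinuous
    and log-convex everywhere, including where they are infinite. Measurability is never given but
    deduced from lower semicontinuity; on the product this requires open sets of the product
    topology to lie in the product sigma-algebra, and finite dimension provides it through a
    countable dense set. Subadditivity of entropy is Gibbs' inequality for [v] against the product
    of its own marginals. *)

(** * Linear functionals bounded on a half space *)

Section lin_functional.
Context (R : realType) (V : normedModType R).
Implicit Types (f : V -> R) (x y z : V) (P : set V).

Lemma lin_functionalD f x y : lin_functional f -> f (x + y) = f x + f y.
Proof. by move=> lf; have := lf 1 x y; rewrite scale1r mul1r. Qed.

Lemma lin_functional0 f : lin_functional f -> f 0 = 0.
Proof.
move=> lf; have := lin_functionalD 0 0 lf; rewrite addr0 => h.
by apply: (addrI (f 0)); rewrite -h addr0.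
Qed.

Lemma lin_functionalZ f a x : lin_functional f -> f (a *: x) = a * f x.
Proof. by move=> lf; have := lf a x 0; rewrite addr0 lin_functional0 // addr0. Qed.

Lemma lin_functionalB f x y : lin_functional f -> f (x - y) = f x - f y.
Proof.
by move=> lf; rewrite lin_functionalD // -scaleN1r lin_functionalZ // mulN1r.
Qed.

Lemma lin_functional_conv f t x y : lin_functional f ->
  f ((1 - t) *: x + t *: y) = (1 - t) * f x + t * f y.
Proof. by move=> lf; rewrite lf lin_functionalZ. Qed.

(* No appeal to finite dimension: a functional bounded above on a ball is Lipschitz. *)
Lemma lin_functional_lipschitz f x c e : lin_functional f -> 0 < e ->
  ball x e `<=` [set y | f y <= c] ->
  exists2 M, 0 < M & forall v, `|f v| <= M * `|v|.
Proof.
move=> lf e0 bP.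
have fxc : f x <= c by apply: bP; apply: ballxx.
(* A step of length [e / 2] from [x] raises [f] by at most [c - f x]; the added 1 makes the constant
   strictly positive, as later divisions by it require. *)
exists (2 * (c - f x) / e + 1) => [|v].
  by apply: ltr_wpDl => //; rewrite divr_ge0 ?(ltW e0) // mulr_ge0 // subr_ge0.
have [->|v0] := eqVneq v 0; first by rewrite lin_functional0 // !normr0 mulr0.
have nv : 0 < `|v| by rewrite normr_gt0.
(* The upper bound is applied to both [v] and [- v]. *)
suff H w : `|w| = `|v| -> f w <= (2 * (c - f x) / e + 1) * `|v|.
  rewrite ler_norml H // andbT lerNl.
  rewrite -[v in f v]opprK -[- - v]sub0r lin_functionalB // lin_functional0 //.
  by rewrite sub0r opprK H // normrN.
move=> nw; set t := e / 2 / `|v|.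
have t0 : 0 < t by rewrite !divr_gt0.
have : f (x + t *: w) <= c.
  apply: bP; rewrite -ball_normE /ball_/= opprD addrA subrr sub0r normrN normrZ.
  rewrite gtr0_norm // nw /t divfK ?gt_eqF //; lra.
rewrite lin_functionalD // lin_functionalZ // => h.
have {}h : t * f w <= c - f x by rewrite lerBrDl.
have : f w <= (c - f x) / t by rewrite ler_pdivlMr // mulrC.
move=> /le_trans; apply.
have -> : (c - f x) / t = 2 * (c - f x) / e * `|v|.
  by rewrite /t; field; rewrite !gt_eqF.
by apply: ler_wpM2r; [exact: ltW | rewrite lerDl].
Qed.

Lemma lin_functional_lt_nbhs f x c M : lin_functional f -> 0 < M ->
  (forall v, `|f v| <= M * `|v|) -> f x < c -> \forall y \near x, f y < c.
Proof.
move=> lf M0 HM fx; apply/nbhs_ballP; exists ((c - f x) / M) => /=.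
  by rewrite divr_gt0 // subr_gt0.
move=> y; rewrite -ball_normE /ball_/= => xy.
have h : `|f (y - x)| <= M * `|x - y| by rewrite distrC; exact: HM.
have : M * `|x - y| < c - f x by rewrite mulrC -ltr_pdivlMr.
move: h; rewrite lin_functionalB // ler_norml => /andP[_].
lra.
Qed.

(** From [z], a short step along [v], signed so that [f] strictly increases, stays in [P], where [f]
    is still at most [c]. *)
Lemma interior_lin_functional_lt f P z c : lin_functional f ->
  (exists v, f v != 0) -> P `<=` [set y | f y <= c] -> interior P z -> f z < c.
Proof.
move=> lf [v fv] Pc /nbhs_ballP[e /= e0 be].
have v0 : v != 0 by apply: contraNneq fv => ->; rewrite lin_functional0.
have nv : 0 < `|v| by rewrite normr_gt0.
set t := Num.sg (f v) * (e / 2 / `|v|).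
have et0 : 0 < e / 2 / `|v| by rewrite !divr_gt0.
have /Pc /= : P (z + t *: v).
  apply: be; rewrite -ball_normE /ball_/= opprD addrA subrr sub0r normrN normrZ.
  rewrite normrM normr_sg fv mul1r gtr0_norm // divfK ?gt_eqF //; lra.
rewrite lin_functionalD // lin_functionalZ //; apply: lt_le_trans.
rewrite ltrDl /t mulrAC -normrEsg mulr_gt0 ?normr_gt0 //.
Qed.

End lin_functional.

(** * Facets cover the boundary of a polytope *)

Section polytope.
Context (R : realType) (V : normedModType R).
Implicit Types P : set V.

Lemma polytope_closed P : polytope P -> closed P.
Proof. by case=> _ cP _; apply: compact_closed => //; exact: norm_hausdorff. Qed.

Lemma polytope_conv P x y t : polytope P -> P x -> P y -> 0 <= t <= 1 ->
  P ((1 - t) *: x + t *: y).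
Proof.
move=> [[m [f [c [lf ->]]]] _ _] /= Px Py /andP[t0 t1] i.
rewrite lin_functional_conv; last by case: (lf i).
have -> : c i = (1 - t) * c i + t * c i by rewrite -mulrDl subrK mul1r.
by apply: lerD; apply: ler_wpM2l => //; rewrite subr_ge0.
Qed.

(* Inequalities of a minimal representation define facets: dropping the i-th one
   admits a point y beyond it, and the segment from an interior point to y leaves P
   through the relative interior of the i-th face. *)
Lemma polytope_boundary_facets P : polytope P ->
  exists (m : nat) (I : {set 'I_m}) (f : 'I_m -> V -> R) (c : 'I_m -> R),
    (forall i, i \in I -> supporting P (f i) (c i) /\
       facet P (P `&` hyperplane (f i) (c i))) /\
    boundary P `<=` \bigcup_(i in [set` I]) (P `&` hyperplane (f i) (c i)).
Proof.
move=> PP; have clP := polytope_closed PP.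
case: PP => -[m [f [c [lf PE]]]] _ [z Pz].
pose Q (I : {set 'I_m}) := [set x | forall i, i \in I -> f i x <= c i].
have [I /[dup] /minsetp /asboolP PI minI] :
    {I : {set 'I_m} | minset (fun I => `[< P = Q I >]) I}.
  apply: ex_minset; exists [set: 'I_m]%SET; apply/asboolP; rewrite PE /Q.
  by apply/seteqP; split=> x /= h i; [move=> _|]; apply: h; rewrite ?inE.
have Pf i : P `<=` [set x | f i x <= c i] by rewrite PE => x /= ; apply.
have /nbhs_ballP[e /= e0 ze] : nbhs z P by [].
have lip i : exists2 M, 0 < M & forall v, `|f i v| <= M * `|v|.
  apply: (@lin_functional_lipschitz _ _ _ z (c i) e) => //.
    by case: (lf i).
  by move=> x /ze /Pf.
have ltn i x : f i x < c i -> \forall y \near x, f i y < c i.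
  have [M M0 HM] := lip i; apply: lin_functional_lt_nbhs M0 HM.
  by case: (lf i).
have fz i : f i z < c i.
  by apply: (@interior_lin_functional_lt _ _ _ P) => //; case: (lf i).
have supp i : supporting P (f i) (c i).
  by split; [case: (lf i)..|exact: Pf].
exists m, I, f, c; split.
- move=> i iI; split=> //; exists (f i), (c i); split=> //.
  have [y [yj yi]] : exists y, (forall j, j \in I -> j != i -> f j y <= c j) /\
      c i < f i y.
    apply: contrapT => nex.
    have : P = Q (I :\ i).
      rewrite {1}PI; apply/seteqP; split=> x /= h j.
        by rewrite in_setD1 => /andP[_ jI]; exact: h.
      move=> jI; have [ji|ji] := eqVneq j i; last by apply: h; rewrite in_setD1 ji.
      rewrite leNgt; apply/negP => cf; apply: nex; exists x; split.
        by move=> k kI ki; apply: h; rewrite in_setD1 ki.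
      by rewrite -ji.
    move=> /asboolP /(minsetinf minI) /(_ (subD1set _ _)) II.
    by move: iI; rewrite -II in_setD1 eqxx.
  (* The parameter at which the segment from [z] to [y] meets the hyperplane. *)
  pose t := (c i - f i z) / (f i y - f i z).
  have fi := fz i.
  have t0 : 0 < t by rewrite divr_gt0 //; lra.
  have t1 : t < 1 by rewrite ltr_pdivrMr; lra.
  pose w := (1 - t) *: z + t *: y.
  have fw j : f j w = (1 - t) * f j z + t * f j y.
    by apply: lin_functional_conv; case: (lf j).
  have wi : f i w = c i.
    by rewrite fw /t; field; rewrite gt_eqF // subr_gt0 (lt_trans fi).
  (* Strict at [z], whose weight [1 - t] is positive, and weak at [y]. *)
  have wj j : j \in I -> j != i -> f j w < c j.
    move=> jI ji; rewrite fw.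
    have := fz j; have := yj _ jI ji => h1 h2.
    have -> : c j = (1 - t) * c j + t * c j by ring.
    by rewrite ltr_leD // ?ltr_pM2l ?ler_pM2l //; lra.
  have : \forall x \near w, forall j, j \in I -> j != i -> f j x < c j.
    apply: filter_forall => j; case: (boolP (j \in I)) => jI; last exact: nearW.
    have [->|ji] := eqVneq j i; first by exact: nearW.
    by apply: filterS (ltn _ _ (wj _ jI ji)).
  move=> /nbhs_ballP[e' /= e'0 be'].
  have sub : ball w e' `&` hyperplane (f i) (c i) `<=`
      P `&` hyperplane (f i) (c i).
    move=> x [/be' /= xj xi]; split=> //; rewrite PI => j jI.
    have [->|ji] := eqVneq j i; first by rewrite xi.
    by apply: ltW; apply: xj.
  exists w; last by exists e'.
  by apply: sub; split => //; apply: ballxx.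
- rewrite /boundary -(closure_id P).1 // => x [Px nx].
  (* A point of [P] at which every inequality of the representation is strict has a neighbourhood
     inside [P]. *)
  apply: contrapT => nex; apply: nx.
  have : \forall y \near x, forall j, j \in I -> f j y < c j.
    apply: filter_forall => j; case: (boolP (j \in I)) => jI; last exact: nearW.
    apply: filterS (ltn j _ _); first by [].
    rewrite lt_neqAle Pf // andbT; apply/negP => /eqP fjx; apply: nex.
    by exists j.
  by apply: filterS => y h; rewrite PI => j jI; apply: ltW; apply: h.
Qed.

End polytope.

(** * Open sets of the product and measurability of semicontinuous functions *)

Section borel.
Context (R : realType).

(** Separability as a family over a [countType], so that two indices and a radius can directly index
    a countable union of boxes. *)
Definition countably_dense (V : normedModType R) : Prop :=
  exists (I : countType) (g : I -> V),
    forall v e, 0 < e -> exists i, ball v e (g i).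

Lemma has_dim_countably_dense (V : normedModType R) n :
  has_dim V n -> countably_dense V.
Proof.
move=> [e He]; exists {ffun 'I_n -> rat}, (fun q : {ffun 'I_n -> rat} => \sum_i ratr (q i) *: e i).
move=> v d d0; have [c [vE _]] := He v.
(* The summand 1 keeps [S] positive in dimension 0 and makes the final estimate strict. *)
pose S := 1 + \sum_i `|e i|.
have S0 : 0 < S by rewrite ltr_wpDr // sumr_ge0.
have ex i : exists q : rat, `|c i - ratr q| < d / S.
  have [|q] := @rat_in_itvoo R (c i - d / S) (c i + d / S).
    by have := divr_gt0 d0 S0; lra.
  rewrite in_itv /= => /andP[h1 h2]; exists q; rewrite ltr_norml.
  by apply/andP; split; lra.
pose q := [ffun i => sval (cid (ex i))].
exists q; rewrite -ball_normE /ball_/= vE -sumrB.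
apply: le_lt_trans (ler_norm_sum _ _ _) _.
apply: (@le_lt_trans _ _ (d / S * \sum_i `|e i|)).
  rewrite mulr_sumr; apply: ler_sum => i _; rewrite -scalerBl normrZ.
  by apply: ler_wpM2r => //; rewrite ffunE; case: cid => ? /= /ltW.
by rewrite mulrAC ltr_pdivrMr // ltr_pM2l // /S ltrDr.
Qed.

(** Every open set is the countable union of the boxes it contains, with centres in the dense
    families and radii [1 / (k + 1)]. *)
Lemma open_measurable_prod d1 d2 (V1 : MeasNormedMod.type R d1)
    (V2 : MeasNormedMod.type R d2) :
  (forall U : set V1, open U -> measurable U) ->
  (forall U : set V2, open U -> measurable U) ->
  countably_dense V1 -> countably_dense V2 ->
  forall U : set (V1 * V2)%type, open U -> measurable U.
Proof.
move=> oV1 oV2 [I1 [g1 D1]] [I2 [g2 D2]] U oU.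
pose B (k : I1 * I2 * nat) : set (V1 * V2)%type :=
  ball (g1 k.1.1) k.2.+1%:R^-1 `*` ball (g2 k.1.2) k.2.+1%:R^-1.
pose F k := if `[< B k `<=` U >] then B k else set0.
have -> : U = \bigcup_k F k.
  apply/seteqP; split; last first.
    by move=> z [k _]; rewrite /F; case: ifPn => // /asboolP; apply.
  move=> [x y] Uxy.
  have /nbhs_ballP[e /= e0 eU] : nbhs (x, y) U by exact: open_nbhs_nbhs.
  have e20 : 0 < e / 2 by rewrite divr_gt0.
  pose n := Num.bound (e / 2)^-1.
  (* Half of [e], because passing through the centre of the box costs its radius twice. *)
  have ne : n.+1%:R^-1 < e / 2.
    rewrite -[ltRHS]invrK ltf_pV2 ?posrE ?invr_gt0 //.
    have /archi_boundP : 0 <= (e / 2)^-1 by rewrite invr_ge0 ltW.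
    by move=> /lt_trans; apply; rewrite ltr_nat.
  have [i xi] := D1 x n.+1%:R^-1 ltac:(by rewrite invr_gt0).
  have [j yj] := D2 y n.+1%:R^-1 ltac:(by rewrite invr_gt0).
  exists (i, j, n) => //; rewrite /F; case: asboolP => [_|].
    by split; apply: ball_sym.
    move=> nB; exfalso; apply: nB => -[x' y'] [/= Bx By].
  have le2 : n.+1%:R^-1 + n.+1%:R^-1 <= e.
    by rewrite [leRHS]splitr lerD // ltW.
  apply: eU; split => /=; apply: (le_ball le2).
    exact: ball_triangle xi Bx.
  exact: ball_triangle yj By.
apply: countable_bigcupT_measurable => // k; rewrite /F; case: ifPn => // _.
by apply: measurableX; [apply: oV1|apply: oV2]; apply: ball_open.
Qed.

Lemma lsc_measurable d (V : MeasNormedMod.type R d) (P : set V) (u : V -> \bar R) :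
  (forall U : set V, open U -> measurable U) ->
  measurable P -> lsc_on P u -> measurable_fun P u.
Proof.
move=> oV mP lu mP'; apply: (measurability _ (ErealGenOInfty.measurableE R)) => //.
move=> /= _ [_ [a ->]] <-; rewrite preimage_itvoy.
(* The union of all balls on whose trace on [P] the bound holds: open in [V], although [u] is
   controlled on [P] only. *)
pose O := \bigcup_(z in [set z : V * R | 0 < z.2 /\
   forall y, P y -> ball z.1 z.2 y -> (a%:E < u y)%E]) ball z.1 z.2.
have -> : P `&` [set x | (a%:E < u x)%E] = P `&` O.
  apply/seteqP; split=> x [Px /=].
    move=> au; split=> //; have [e e0 He] := lu _ Px _ au.
    exists (x, e); last exact: ballxx.
    split=> //= y Py; rewrite -ball_normE /ball_/= distrC; exact: He.
  by move=> [[z e] [/= e0 He] be]; split=> //=; apply: He.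
apply: measurableI => //; apply: oV; apply: bigcup_open => z _.
exact: ball_open.
Qed.

End borel.

(** * Finiteness of the measures of a system *)

Section finite_measure_of.
Local Open Scope ereal_scope.
Context d (T : measurableType d) (R : realType).
Variables (mu : {measure set T -> \bar R}) (mu_fin : mu setT < +oo).

(* The vacuous [let] keeps the finiteness proof as an argument, where the
   [isFinite] instance finds it. *)
Definition finite_measure_of : set T -> \bar R := let _ := mu_fin in mu.

HB.instance Definition _ := Measure.copy finite_measure_of mu.
HB.instance Definition _ := @Measure_isFinite.Build _ _ _ finite_measure_of
  (lty_fin_num_fun mu_fin).

End finite_measure_of.

Lemma measure_bigsetU_lty d (T : measurableType d) (R : realType)
    (mu : {measure set T -> \bar R}) (I : Type) (r : seq I) (P : pred I)
    (F : I -> set T) :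
  (forall i, P i -> measurable (F i) /\ (mu (F i) < +oo)%E) ->
  (mu (\big[setU/set0]_(i <- r | P i) F i) < +oo)%E.
Proof.
(* Measurability of the partial unions is carried along because subadditivity asks for it. *)
move=> PF; suff [] : measurable (\big[setU/set0]_(i <- r | P i) F i) /\
  (mu (\big[setU/set0]_(i <- r | P i) F i) < +oo)%E by [].
apply: (big_ind (fun A => measurable A /\ (mu A < +oo)%E)) => //.
  by split => //; rewrite measure0.
move=> A B [mA A1] [mB B1]; split; first exact: measurableU.
by apply: le_lt_trans (measureU2 mu mA mB) _; exact: lte_add_pinfty.
Qed.

Section system.
Local Open Scope ereal_scope.
Context (R : realType) (d : measure_display) (V : MeasNormedMod.type R d).
Implicit Types (P : set V) (dmu dsigma : set V -> \bar R).

(** The measures are assumed finite only on bounded open sets, or their traces on hyperplanes; this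
    one neighbourhood bounds the volume and every facet. *)
Lemma polytope_bounded_open P : polytope P ->
  exists B : set V, [/\ open B, bounded_set B, B !=set0 & P `<=` B].
Proof.
case=> _ /compact_bounded[M [_ HM]] [z /interior_subset Pz].
(* Norms on [P] are at most any number above [M], for instance [|M| + 1]; the extra unit makes the
   inequality strict, as the open ball demands. *)
exists (ball (0%R : V) (`|M| + 2)); split.
- exact: ball_open.
- exists (`|M| + 2)%R; split => // r lr x; rewrite -ball_normE /ball_/= sub0r normrN.
  by move=> /ltW xM; apply: le_trans xM _; exact: ltW.
- by exists 0%R; apply: ballxx; rewrite ltr_wpDl.
- move=> x Px; rewrite -ball_normE /ball_/= sub0r normrN.
  have /HM : (M < `|M| + 1)%R by rewrite (le_lt_trans (ler_norm M)) // ltrDl.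
  by move=> /(_ _ Px) /= /le_lt_trans; apply; rewrite ltrD2l ltr1n.
Qed.

Lemma is_system_open_measurable n P dmu dsigma : is_system n P dmu dsigma ->
  forall U : set V, open U -> measurable U.
Proof. by case=> _ -> _ _ _ U oU; apply: sub_sigma_algebra. Qed.

(** The bare set functions of a system become finite measures, the form in which Tonelli's theorem
    applies to them. *)
Lemma is_system_measures n P dmu dsigma : is_system n P dmu dsigma ->
  exists m s : {finite_measure set V -> \bar R},
    [/\ dmu = m, dsigma = s, 0 < m P & s (~` boundary P) = 0].
Proof.
move=> sysP; have oV := is_system_open_measurable sysP.
case: sysP => _ _ [PP _] [mu [[_ muB] ->]] [s [-> sb sF]].
have [B [oB bB B0 PB]] := polytope_bounded_open PP.
have cP := polytope_closed PP.
have mP : measurable P by rewrite -[P]setCK; apply: measurableC; apply: oV; exact: closed_openC.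
have mB0 : measurable B by exact: oV.
have mu_fin : mrestr mu mP setT < +oo.
  rewrite /mrestr setTI; apply: le_lt_trans (le_measure mu _ _ PB) _; rewrite ?inE //.
  by have /andP[] := muB _ oB bB B0.
have s_fin : s setT < +oo.
  have [m [I [f [c [FI bI]]]]] := polytope_boundary_facets PP.
  have mH i : i \in I -> measurable (hyperplane (f i) (c i)).
    move=> iI; have [[lf _ fc] _] := FI _ iI.
    have [z iz] : interior P !=set0 by case: PP.
    have /nbhs_ballP[e /= e0 ze] : nbhs z P by [].
    have [M M0 HM] : exists2 M, (0 < M)%R & forall v, (`|f i v| <= M * `|v|)%R.
      apply: (@lin_functional_lipschitz _ _ _ z (c i) e) => //.
      by move=> x /ze /fc.
    (* The complement of two open half spaces; openness rests on the Lipschitz bound, since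
       functionals are not assumed continuous. *)
    have -> : hyperplane (f i) (c i) =
        ~` ([set x | (f i x < c i)%R] `|` [set x | (- f i x < - c i)%R]).
      apply/seteqP; split=> x /=; rewrite /hyperplane /= ltrN2.
        by move=> <- []; rewrite ltxx.
      by move=> h; apply/eqP; rewrite eq_le !leNgt; apply/andP; split;
        apply/negP => h'; apply: h; [right|left].
    apply: measurableC; apply: measurableU; apply: oV; rewrite openE => x /=;
      rewrite /interior.
      exact: (lin_functional_lt_nbhs lf M0 HM).
    apply: (@lin_functional_lt_nbhs _ _ (fun x => - f i x)%R _ _ M) => //.
      by move=> a y w; rewrite lf opprD mulrN.
    by move=> v; rewrite normrN; exact: HM.
  have -> : [set: V] = boundary P `|` ~` boundary P by rewrite setUv.
  have mb : measurable (boundary P).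
    rewrite /boundary -(closure_id P).1 //; apply: measurableD => //.
    by apply: oV; exact: open_interior.
  apply: le_lt_trans (measureU2 s mb (measurableC mb)) _; rewrite [X in _ + X]sb adde0.
  have mPH i : i \in I -> measurable (P `&` hyperplane (f i) (c i)).
    by move=> iI; apply: measurableI => //; exact: mH.
  have {}bI : boundary P `<=` \big[setU/set0]_(i in I) (P `&` hyperplane (f i) (c i)).
    rewrite -big_enum -bigcup_seq => x /bI[i iI Hx].
    by exists i => //=; rewrite mem_enum.
  have mU : measurable (\big[setU/set0]_(i in I) (P `&` hyperplane (f i) (c i))).
    exact: bigsetU_measurable.
  apply: le_lt_trans (le_measure s _ _ bI) _; rewrite ?inE //.
  apply: measure_bigsetU_lty => i iI; split; first exact: mPH.
  have [sup fac] := FI _ iI.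
  (* On the facet [s] agrees with [nu], which is finite on the trace of [B] on the hyperplane. *)
  have [nu [[_ _ nuB] ->]] := sF _ _ fac sup; [|exact: mPH|by []].
  have ne : (B `&` hyperplane (f i) (c i)) !=set0.
    case: fac => g [b [_ _ [x [Px Hx] _]]].
    by exists x; split => //; exact: PB.
  have /andP[_] := nuB _ oB bB ne; apply: le_lt_trans.
  apply: le_measure; rewrite ?inE; [exact: mPH| |exact: setSI].
  by apply: measurableI => //; exact: mH.
exists (finite_measure_of mu_fin), (finite_measure_of s_fin); split => //.
- rewrite /finite_measure_of /= /mrestr setIid.
  have [z iz] : interior P !=set0 by case: PP.
  have iPB : interior P `<=` B by move=> x /interior_subset /PB.
  have biP : bounded_set (interior P).
    by case: bB => M [Mr HM]; exists M; split=> // r lr x /iPB; exact: (HM r lr).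
  have /andP[+ _] := muB (interior P) (@open_interior _ _) biP (ex_intro _ z iz).
  move=> /lt_le_trans; apply; apply: le_measure; rewrite ?inE //.
    by apply: oV; exact: open_interior.
  exact: interior_subset.
Qed.

End system.

(** * Pointwise entropy inequalities *)

Section real_entropy.
Context (R : realType).
Implicit Types a b c r : R.

(** This is [ln (1 + t) <= t] at [t = b / a - 1], multiplied by [a]. Taking [b = 1] gives the sign
    of [ent_dens], [a = 1] that of [ent_rate], and [b] a product of marginals gives subadditivity of
    entropy. *)
Lemma gibbs_inequality a b : 0 <= a -> 0 < b -> a * ln b + a - b <= a * ln a.
Proof.
rewrite le_eqVlt => /predU1P[<- b0|a0 b0]; first by rewrite !mul0r; lra.
have h : ln (1 + (b / a - 1)) <= b / a - 1.
  by apply: le_ln1Dx; rewrite ltrBrDl subrr divr_gt0.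
move: h; rewrite addrC subrK ln_div ?posrE // => h.
have : a * (ln b - ln a) <= a * (b / a - 1) by rewrite ler_pM2l.
by rewrite !mulrBr mulrCA divff ?gt_eqF // !mulr1; lra.
Qed.

End real_entropy.

Section extended.
Local Open Scope ereal_scope.
Context (R : realType).
Implicit Types (x y z : \bar R) (g : R -> R).

(** One extension for [xlogx], [ent_dens] and [ent_rate], so that measurability is proved once. At
    [-oo] its value is [g 0], which agrees with [xlogx] there because [0 * ln 0 = 0]. *)
Definition eext g x : \bar R := if x == +oo then +oo else (g (fine x))%:E.

Lemma measurable_eext g : measurable_fun setT g -> measurable_fun setT (eext g).
Proof.
move=> mg; apply: measurable_fun_ifT => //.
  by apply: measurable_fun_eqe => //; exact: measurable_cst.
by apply/measurable_EFinP; apply: measurableT_comp => //; exact: fine_measurable.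
Qed.

Lemma eext_ge0 g x : (forall r, 0 <= r -> 0 <= g r)%R -> 0 <= x -> 0 <= eext g x.
Proof.
move=> g0; case: x => [r| |] // r0; rewrite /eext //=.
by rewrite lee_fin g0.
Qed.

Definition ent_dens : \bar R -> \bar R := eext (fun r => r * ln r - r + 1)%R.

(* The function [ent_dens x / x]. *)
Definition ent_rate : \bar R -> \bar R := eext (fun r => ln r - 1 + r `^ (- 1))%R.

(* A power rather than [^-1] to get measurability; [einv +oo = 0]. *)
Definition einv x : \bar R := (fine x `^ (- 1))%:E.

Lemma xlogxE x : xlogx x = eext (fun r => r * ln r)%R x.
Proof. by case: x => [r| |] //; rewrite /eext /= mul0r. Qed.

Lemma measurable_xlogx : measurable_fun setT (@xlogx R).
Proof.
rewrite (_ : @xlogx R = eext (fun r => r * ln r)%R); last exact/funext/xlogxE.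
by apply: measurable_eext; apply: measurable_funM => //; exact: measurable_ln.
Qed.

Lemma measurable_ent_dens : measurable_fun setT ent_dens.
Proof.
apply: measurable_eext; apply: measurable_funD => //; apply: measurable_funB => //.
by apply: measurable_funM => //; exact: measurable_ln.
Qed.

Lemma measurable_ent_rate : measurable_fun setT ent_rate.
Proof.
apply: measurable_eext; apply: measurable_funD => //.
by apply: measurable_funB => //; exact: measurable_ln.
Qed.

Lemma measurable_einv : measurable_fun setT einv.
Proof.
apply/measurable_EFinP; apply: (@measurableT_comp _ _ _ _ _ _ (fun r : R => r `^ (- 1))%R) => //.
Qed.

Lemma ent_dens_ge0 x : 0 <= x -> 0 <= ent_dens x.
Proof.
apply: eext_ge0 => r r0; have := @gibbs_inequality R r 1 r0 ltr01.
by rewrite ln1; lra.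
Qed.

Lemma ent_rate_ge0 x : 0 < x -> 0 <= ent_rate x.
Proof.
case: x => [r| |] //; rewrite /ent_rate /eext //= !lte_fin lee_fin => r0;
  rewrite powR_inv1 ?(ltW r0) //.
have := @gibbs_inequality R 1 r^-1 ler01; rewrite invr_gt0 => /(_ r0).
by rewrite ln1 lnV ?posrE //; lra.
Qed.

Lemma einv_ge0 x : 0 <= x -> 0 <= einv x.
Proof. by move=> x0; rewrite lee_fin powR_ge0. Qed.

(** Not an equality: the product is 0 at [0] and at [+oo]. An upper bound is all that the integrated
    inequality asks of this term. *)
Lemma einv_mul_le1 x : 0 <= x -> einv x * x <= 1.
Proof.
case: x => [r| |] //; rewrite /einv /= => r0; rewrite powR_inv1 // ?invr0 ?mul0e //.
rewrite -EFinM lee_fin; have [->|r1] := eqVneq r 0%R; first by rewrite mulr0.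
by rewrite mulVf.
Qed.

Lemma ent_rate_mul x : 0 < x -> ent_rate x * x = ent_dens x.
Proof.
case: x => [r| |] //; rewrite /ent_rate /ent_dens /eext /= => r0.
  rewrite lte_fin in r0; rewrite -EFinM powR_inv1 ?(ltW r0) //.
  by congr EFin; field; rewrite gt_eqF.
Qed.

(* With [x] a density and [y], [z] its marginals this is Gibbs' inequality for [x]
   against [y * z], rearranged so that every term is nonnegative; integrated, all
   terms but the three entropies cancel. *)
Lemma ent_dens_superadd x y z : 0 <= x -> 0 < y -> 0 < z ->
  x * ent_rate y + x * ent_rate z + x + x + 1 <=
  ent_dens x + y * z + x * einv y + x * einv z.
Proof.
move=> x0 y0 z0.
have e0 := @ent_dens_ge0 x x0.
have yz0 : 0 <= y * z by apply: mule_ge0; exact: ltW.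
have xy0 : 0 <= x * einv y by apply: mule_ge0 => //; apply: einv_ge0; exact: ltW.
have xz0 : 0 <= x * einv z by apply: mule_ge0 => //; apply: einv_ge0; exact: ltW.
(* If [x] or [y * z] is infinite, so is the right side. Otherwise all three are real, because [y]
   and [z] are positive. *)
have [xy|xy] := eqVneq x +oo.
  rewrite [X in _ <= X + _ + _ + _](_ : _ = +oo); last by rewrite xy.
  by rewrite !addye ?leey // gt_eqF // (lt_le_trans (ltNyr 0)).
have [yy|yy] := eqVneq (y * z) +oo.
  rewrite [X in _ <= _ + X + _ + _]yy addey; last by rewrite gt_eqF // (lt_le_trans (ltNyr 0)).
  by rewrite !addye ?leey // gt_eqF // (lt_le_trans (ltNyr 0)).
move: x0 {e0 xy0 xz0} xy; case: x => [a| |] // a0 _.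
move: y0 {yz0} yy; case: y => [b| |] // b0; last by move=> /eqP[]; rewrite gt0_mulye.
move: z0; case: z => [c| |] // c0; last by move=> /eqP[]; rewrite gt0_muley.
move=> _; rewrite /ent_rate /ent_dens /eext /einv /= -!EFinM -!EFinD lee_fin.
rewrite !lee_fin in a0; rewrite !lte_fin in b0 c0; rewrite !powR_inv1 ?(ltW b0, ltW c0) //.
have := @gibbs_inequality R a (b * c) a0 (mulr_gt0 b0 c0).
rewrite lnM ?posrE //; lra.
Qed.

(** This is [ln (x * y) = ln x + ln y] with every negative term moved across, which keeps it true at
    [+oo]. *)
Lemma ent_densM x y : 0 < x -> 0 < y ->
  ent_dens (x * y) + x + y = y * ent_dens x + x * ent_dens y + x * y + 1.
Proof.
move=> x0 y0; have ex := ent_dens_ge0 (ltW x0); have ey := ent_dens_ge0 (ltW y0).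
have nn (w : \bar R) : 0 <= w -> w != -oo by move=> w0; rewrite gt_eqF // (lt_le_trans (ltNyr 0)).
have dy : ent_dens +oo = +oo :> \bar R by [].
case: x x0 ex => [a| |] // a0 ex; last first.
  rewrite (gt0_mulye y0) dy (gt0_muley y0).
  by rewrite !addye ?nn ?mule_ge0 //; exact: ltW.
case: y y0 ey => [b| |] // b0 ey; last first.
  rewrite (gt0_muley a0) dy ?(gt0_muley a0).
  by rewrite !(addye, addey) ?nn ?mule_ge0 //; exact: ltW.
rewrite /ent_dens /eext /= -!EFinM -!EFinD /=; congr EFin.
rewrite !lte_fin in a0 b0; rewrite lnM ?posrE //; ring.
Qed.

End extended.

(** * Entropy as the integral of a nonnegative function *)

Section integral_xlogx.
Local Open Scope ereal_scope.
Context d (T : measurableType d) (R : realType) (mu : {measure set T -> \bar R}).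
Variables (D : set T) (mD : measurable D) (muD : mu D < +oo).

Lemma integral1 : \int[mu]_(x in D) 1 = mu D.
Proof. by rewrite integral_cst // mul1e. Qed.

Lemma fin_num_muD : mu D \is a fin_num.
Proof. by rewrite ge0_fin_numE. Qed.

(* [x ln x] and [ent_dens x] differ by [x - 1], whose integral vanishes. *)
Lemma integral_xlogx (v : T -> \bar R) : measurable_fun D v ->
  (forall x, D x -> 0 <= v x) -> \int[mu]_(x in D) v x = \int[mu]_(x in D) 1 ->
  \int[mu]_(x in D) xlogx (v x) = \int[mu]_(x in D) ent_dens (v x).
Proof.
move=> mv v0; rewrite integral1 => vD.
have mx : measurable_fun D (fun x => xlogx (v x)).
  by apply: (measurableT_comp (@measurable_xlogx R)).
have me : measurable_fun D (fun x => ent_dens (v x)).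
  by apply: (measurableT_comp (@measurable_ent_dens R)).
have mp := measurable_funepos mx; have mn := measurable_funeneg mx.
have e0 x : D x -> 0 <= ent_dens (v x) by move=> Dx; apply/ent_dens_ge0/v0.
(* The identity [x ln x + 1 = ent_dens x + x] with the negative part of [x ln x] moved to the
   right. *)
have pw x : D x -> (fun x => xlogx (v x))^\+ x + 1 =
    ent_dens (v x) + v x + (fun x => xlogx (v x))^\- x.
  move=> Dx; rewrite funeposE funenegE.
  case: (v x) (v0 _ Dx) => [r| |] //= _; last first.
    by rewrite /ent_dens /eext /= !maxEge !leey /= !addye.
  rewrite /ent_dens /eext /= -!EFin_max -!EFinD; congr EFin.
  set a := (r * ln r)%R; have [a0|a0] := leP 0%R a.
    by rewrite max_r ?oppr_le0 //; lra.
  by rewrite max_l ?oppr_ge0 ?(ltW a0) //; lra.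
(* Since [x ln x >= x - 1 >= -1]; on a set of finite measure the negative part thus has a finite
   integral, which can be subtracted. *)
have n1 x : D x -> (fun x => xlogx (v x))^\- x <= 1.
  move=> Dx; rewrite funenegE.
  case: (v x) (v0 _ Dx) => [r| |] //=; last by rewrite ge_max leNye lee01.
  rewrite lee_fin => r0; rewrite -EFin_max lee_fin ge_max ler01 andbT.
  by have := @gibbs_inequality R r 1 r0 ltr01; rewrite ln1; lra.
have : \int[mu]_(x in D) ((fun x => xlogx (v x))^\+ x + 1) =
   \int[mu]_(x in D) (ent_dens (v x) + v x + (fun x => xlogx (v x))^\- x).
  by apply: eq_integral => x /[1!inE]; exact: pw.
rewrite !ge0_integralD //; last 2 first.
- by move=> x Dx; apply: adde_ge0; [exact: e0|exact: v0].
- exact: emeasurable_funD.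
rewrite vD integral1 => E; rewrite [LHS]integralE; move: E.
set a := \int[mu]_(x in D) _^\+ x; set b := \int[mu]_(x in D) ent_dens _.
set c := \int[mu]_(x in D) _^\- x.
have cf : c \is a fin_num.
  rewrite ge0_fin_numE; last by apply: integral_ge0.
  apply: le_lt_trans muD; rewrite -integral1; apply: ge0_le_integral => //.
have Df := fin_num_muD.
rewrite addeAC => /(congr1 (fun z => z - mu D)).
by rewrite !addeK // => ->; rewrite addeK.
Qed.

End integral_xlogx.

(** * Tonelli on a rectangle, by extending the integrand by zero *)

Section tonelli.
Local Open Scope ereal_scope.
Context d1 d2 (T1 : measurableType d1) (T2 : measurableType d2) (R : realType).
Variables (A : set T1) (B : set T2).
Hypotheses (mA : measurable A) (mB : measurable B).
Variable f : T1 * T2 -> \bar R.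
Hypotheses (mf : measurable_fun (A `*` B) f)
  (f0 : forall z, (A `*` B) z -> 0 <= f z).

Let mf' : measurable_fun setT (f \_ (A `*` B)).
Proof. exact: ((measurable_restrictT f (measurableX mA mB)).1 mf). Qed.

Let f0' z : 0 <= (f \_ (A `*` B)) z.
Proof. by rewrite patchE; case: ifPn => // /[1!inE]; exact: f0. Qed.

Let fA (m2 : {sigma_finite_measure set T2 -> \bar R}) x : A x ->
  \int[m2]_y (f \_ (A `*` B)) (x, y) = \int[m2]_(y in B) f (x, y).
Proof.
move=> Ax; rewrite [RHS]integral_mkcond; apply: eq_integral => y _.
by rewrite !patchE in_setX (mem_set Ax).
Qed.

Let fB (m1 : {sigma_finite_measure set T1 -> \bar R}) y : B y ->
  \int[m1]_x (f \_ (A `*` B)) (x, y) = \int[m1]_(x in A) f (x, y).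
Proof.
move=> By; rewrite [RHS]integral_mkcond; apply: eq_integral => x _.
by rewrite !patchE in_setX (mem_set By) andbT.
Qed.

Lemma tonelli_rect1 (m1 : {sigma_finite_measure set T1 -> \bar R})
    (m2 : {sigma_finite_measure set T2 -> \bar R}) :
  \int[m1 \x m2]_(z in A `*` B) f z =
  \int[m1]_(x in A) \int[m2]_(y in B) f (x, y).
Proof.
rewrite integral_mkcond fubini_tonelli1 // [RHS]integral_mkcond.
apply: eq_integral => x _; rewrite /fubini_F patchE.
case: ifPn => [/[1!inE]|nA]; first exact: fA.
by apply: integral0_eq => y _; rewrite patchE in_setX (negbTE nA).
Qed.

Lemma tonelli_rect2 (m1 : {sigma_finite_measure set T1 -> \bar R})
    (m2 : {sigma_finite_measure set T2 -> \bar R}) :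
  \int[m1 \x m2]_(z in A `*` B) f z =
  \int[m2]_(y in B) \int[m1]_(x in A) f (x, y).
Proof.
rewrite integral_mkcond fubini_tonelli2 // [RHS]integral_mkcond.
apply: eq_integral => y _; rewrite /fubini_G patchE.
case: ifPn => [/[1!inE]|nB]; first exact: fB.
by apply: integral0_eq => x _; rewrite patchE in_setX (negbTE nB) andbF.
Qed.

Lemma measurable_fun_section1 (x : T1) : A x -> measurable_fun B (fun y => f (x, y)).
Proof.
move=> Ax; have := measurable_fun_pair2 x mf'.
move=> /(measurable_funS measurableT (@subsetT _ B)); apply: eq_measurable_fun.
by move=> y /[1!inE] By; rewrite patchE mem_set.
Qed.

Lemma measurable_fun_section2 (y : T2) : B y -> measurable_fun A (fun x => f (x, y)).
Proof.
move=> By; have := measurable_fun_pair1 y mf'.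
move=> /(measurable_funS measurableT (@subsetT _ A)); apply: eq_measurable_fun.
by move=> x /[1!inE] Ax; rewrite patchE mem_set.
Qed.

End tonelli.

(** * Averages of semicontinuous and log-convex families *)

Section mean.
Local Open Scope ereal_scope.
Context (R : realType).

Lemma powR_young (p q t : R) : (0 <= p -> 0 <= q -> 0 < t < 1 ->
  p `^ (1 - t) * q `^ t <= (1 - t) * p + t * q)%R.
Proof.
move=> p0 q0 /andP[t0 t1]; have t1' : (0 < 1 - t)%R by rewrite subr_gt0.
have := @conjugate_powR R (p `^ (1 - t))%R (q `^ t)%R (1 - t)^-1%R t^-1%R.
rewrite !invr_gt0 !invrK !powR_ge0 => /(_ isT isT t1' t0).
rewrite subrK => /(_ erefl).
by rewrite -!powRrM !divff ?gt_eqF // !powRr1 // [(p * _)%R]mulrC [(q * _)%R]mulrC.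
Qed.

(** Young's inequality for [a / p] and [b / q]. When [p] and [q] are the means of [a] and [b], the
    last factor has mean 1, so averaging yields Hölder's inequality. *)
Lemma poweR_young (a b : \bar R) (p q t : R) : 0 < a -> 0 < b ->
  (0 < p)%R -> (0 < q)%R -> (0 < t < 1)%R ->
  a `^ (1 - t) * b `^ t <= (p `^ (1 - t) * q `^ t)%:E *
     (((1 - t) / p)%:E * a + (t / q)%:E * b).
Proof.
move=> a0 b0 p0 q0 t01; have /andP[t0 t1] := t01.
have t1' : (0 < 1 - t)%R by rewrite subr_gt0.
have k0 : (0 < p `^ (1 - t) * q `^ t)%R by rewrite mulr_gt0 ?powR_gt0.
have pt : (0 < (1 - t) / p)%R by rewrite divr_gt0.
have qt : (0 < t / q)%R by rewrite divr_gt0.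
case: a a0 => [a| |] // a0; last first.
  rewrite gt0_muley ?lte_fin // addye ?gt0_muley ?lte_fin ?leey //.
  by rewrite gt_eqF // (lt_le_trans (ltNyr 0)) // mule_ge0 ?lee_fin ?ltW.
case: b b0 => [b| |] // b0; last first.
  by rewrite (gt0_muley (x := (t / q)%:E)) ?lte_fin // addey // gt0_muley ?leey.
rewrite !poweR_EFin -!(EFinM, EFinD) lee_fin.
rewrite !lte_fin in a0 b0.
have ap : (0 <= a / p)%R by rewrite divr_ge0 // ltW.
have bq : (0 <= b / q)%R by rewrite divr_ge0 // ltW.
have := powR_young ap bq t01; move=> h; have {}h := ler_wpM2l (ltW k0) h.
rewrite ![(_ / _ * _)%R]mulrAC -![((_ * _) / _)%R]mulrA.
apply: le_trans h; rewrite mulrACA -!powRM ?(ltW p0) ?(ltW q0) //.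
by rewrite ![(_ * (_ / _))%R]mulrC !divfK ?lt0r_neq0.
Qed.

Lemma limn_einf_le (u : (\bar R)^nat) c : (forall n, u n <= c) -> limn_einf u <= c.
Proof.
move=> uc; rewrite limn_einf_lim (cvg_lim _ (@cvg_einfs_sup _ _)) //.
apply: ge_ereal_sup => _ [n _ <-]; apply: le_trans (uc n).
by apply: ereal_inf_lbound; exists n => /=.
Qed.

(** Real levels below [c], each eventually exceeded: exactly what lower semicontinuity gives along a
    convergent sequence. *)
Lemma le_limn_einf (u : (\bar R)^nat) c :
  (forall a : R, a%:E < c -> exists n, forall k, (n <= k)%N -> a%:E <= u k) ->
  c <= limn_einf u.
Proof.
move=> H; rewrite limn_einf_lim (cvg_lim _ (@cvg_einfs_sup _ _)) //.
set s := ereal_sup _.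
have Hs (a : R) : a%:E < c -> a%:E <= s.
  move=> /H[n nu]; apply: le_ereal_sup_tmp; exists (einfs u n); first by exists n.
  by apply: le_ereal_inf_tmp => _ [k /= nk <-]; exact: nu.
(* A real number above [s] and below [c] contradicts [Hs]; it is chosen separately when one of them
   is infinite. *)
rewrite leNgt; apply/negP => sc.
case: s sc Hs => [s| |]; last first.
- case: c {H} => [c| |] // _ Hs.
    by have := Hs (c - 1)%R; rewrite lte_fin ltrBlDr ltrDl ltr01 => /(_ isT).
  by have := Hs 0%R (ltry _).
- by rewrite ltNge leey.
case: c {H} => [c| |] // sc Hs.
  rewrite lte_fin in sc; have := Hs ((s + c) / 2)%R; rewrite lte_fin lee_fin.
  by rewrite midf_lt // => /(_ isT); rewrite leNgt midf_lt.
by have := Hs (s + 1)%R (ltry _); rewrite lee_fin gerDl ler10.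
Qed.

Context d (V : MeasNormedMod.type R d) (P : set V).
Context d' (T : measurableType d') (mu : {measure set T -> \bar R}).
Variables (Q : set T) (mQ : measurable Q) (muQ : 0 < mu Q < +oo).

(** The averaged variable lives in a bare measurable space, so that the same definition gives both
    marginals and [neg_entropy]. *)
Definition mean (f : T -> \bar R) : \bar R :=
  ((fine (mu Q))^-1)%:E * \int[mu]_(y in Q) f y.

Let muQf : mu Q \is a fin_num.
Proof. by case/andP: muQ => a b; rewrite ge0_fin_numE // ltW. Qed.

Let A0 : (0 < fine (mu Q))%R.
Proof. by apply: fine_gt0. Qed.

Lemma integral_meanE f : \int[mu]_(y in Q) f y = mu Q * mean f.
Proof. by rewrite -{1}(fineK muQf) muleA -EFinM divff ?gt_eqF // mul1e. Qed.

(** A zero integral would make [f] vanish almost everywhere on [Q], hence [Q] negligible. *)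
Lemma mean_gt0 f : measurable_fun Q f -> (forall y, Q y -> 0 < f y) -> 0 < mean f.
Proof.
move=> mf f0; have i0 : 0 <= \int[mu]_(y in Q) f y.
  by apply: integral_ge0 => y /f0/ltW.
rewrite mule_gt0 ?lte_fin ?invr_gt0 // lt_neqAle i0 andbT eq_sym; apply/eqP => fi0.
have : \int[mu]_(y in Q) `|f y| = 0.
  rewrite -fi0; apply: eq_integral => y /[1!inE] Qy; rewrite gee0_abs //.
  exact/ltW/f0.
move=> /(ae_eq_integral_abs mu mQ mf) H.
have : mu.-negligible Q.
  apply: negligibleS H => y Qy /= /(_ Qy) fy0.
  by have := f0 _ Qy; rewrite fy0 ltxx.
by move=> /(measure_negligible mQ) Q0; move: muQ; rewrite Q0 ltxx.
Qed.

Variable w : V -> T -> \bar R.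
Hypotheses (mw : forall x, P x -> measurable_fun Q (w x))
  (w0 : forall x y, P x -> Q y -> 0 < w x y).

Lemma mean_lsc : (forall y, Q y -> lsc_on P (w^~ y)) ->
  lsc_on P (fun x => mean (w x)).
Proof.
move=> lw x Px a ax; apply: contrapT => ne.
(* If semicontinuity fails at [x], points converging to [x] keep their means at most [a]; Fatou
   along them bounds the mean at [x] by [a] as well. *)
have /choice[z Hz] n : exists z, [/\ P z, (`|z - x| < n.+1%:R^-1)%R & mean (w z) <= a%:E].
  apply: contrapT => nz; apply: ne; exists n.+1%:R^-1%R; first by rewrite invr_gt0.
  move=> z Pz zx; rewrite ltNge; apply/negP => za; apply: nz; by exists z.
have zP n : P (z n) by case: (Hz n).
have : \int[mu]_(y in Q) w x y <= \int[mu]_(y in Q) limn_einf (fun n => w (z n) y).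
  apply: ge0_le_integral => //.
  - by move=> y Qy; apply/ltW/w0.
  - exact: mw.
  (* [limn_einf] is minus the [limn_esup] of the negated sequence. *)
  - apply: measurableT_comp => //.
    apply: (@measurable_fun_limn_esup _ _ _ _ (fun n y => - w (z n) y)) => n.
    by apply: measurableT_comp => //; exact: mw.
  move=> y Qy; apply: le_limn_einf => b bx.
  have [e e0 He] := lw _ Qy _ Px _ bx.
  pose n := Num.bound e^-1; exists n => k nk; apply/ltW/He => //.
  case: (Hz k) => _ /lt_trans + _; apply.
  rewrite -[ltRHS]invrK ltf_pV2 ?posrE ?invr_gt0 //.
  have /archi_boundP : (0 <= e^-1)%R by rewrite invr_ge0 ltW.
  by move=> /lt_le_trans; apply; rewrite ler_nat (leq_trans nk).
move=> /le_trans /(_ (fatou mu mQ (fun n => mw (zP n)) (fun n y Qy => ltW (w0 (zP n) Qy)))).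
have : limn_einf (fun n => \int[mu]_(y in Q) w (z n) y) <= mu Q * a%:E.
  apply: limn_einf_le => n; rewrite integral_meanE; apply: lee_wpmul2l => //.
  by case: (Hz n).
move=> /[swap] /le_trans /[apply]; rewrite integral_meanE leNgt => /negP; apply.
by rewrite lte_pmul2l //; case/andP: muQ.
Qed.

(** Hölder's inequality by normalisation: [poweR_young] is averaged with [p] and [q] the means at
    the endpoints. It needs [0 < t < 1] and finite positive means, so the other cases are settled
    first. *)
Lemma mean_log_convex : (forall y, Q y -> log_convex_on P (w^~ y)) ->
  (forall x y t, P x -> P y -> (0 <= t <= 1)%R -> P ((1 - t) *: x + t *: y)%R) ->
  log_convex_on P (fun x => mean (w x)).
Proof.
move=> lw cP x z t Px Pz /andP[t0 t1].
have mx := mean_gt0 (mw Px) (fun y Qy => w0 Px Qy).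
have mz := mean_gt0 (mw Pz) (fun y Qy => w0 Pz Qy).
have [->|t0'] := eqVneq t 0%R.
  by rewrite subr0 scale1r scale0r addr0 poweRe0 poweRe1 ?mule1 ?(ltW mx).
have [->|t1'] := eqVneq t 1%R.
  by rewrite subrr scale1r scale0r add0r poweRe0 poweRe1 ?mul1e ?(ltW mz).
have {}t0 : (0 < t)%R by rewrite lt_neqAle eq_sym t0' t0.
have {}t1 : (t < 1)%R by rewrite lt_neqAle t1' t1.
have s0 : (0 < 1 - t)%R by rewrite subr_gt0.
(* The other factor is positive, so an infinite mean makes the right side infinite. *)
have [xy|xy] := eqVneq (mean (w x)) +oo.
  by rewrite xy poweRyr ?gt_eqF // gt0_mulye ?leey // poweR_gt0.
have [zy|zy] := eqVneq (mean (w z)) +oo.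
  by rewrite zy poweRyr ?gt_eqF // gt0_muley ?leey // poweR_gt0.
have [p pE] : exists p, mean (w x) = p%:E.
  by case: (mean _) mx xy => [p| |] // _ _; exists p.
have [q qE] : exists q, mean (w z) = q%:E.
  by case: (mean _) mz zy => [q| |] // _ _; exists q.
have p0 : (0 < p)%R by rewrite -lte_fin -pE.
have q0 : (0 < q)%R by rewrite -lte_fin -qE.
have k0 : (0 <= p `^ (1 - t) * q `^ t)%R by rewrite mulr_ge0 ?powR_ge0.
have pt : (0 <= (1 - t) / p)%R by rewrite divr_ge0 // ltW.
have qt : (0 <= t / q)%R by rewrite divr_ge0 // ltW.
have Pxz : P ((1 - t) *: x + t *: z)%R by apply: cP => //; rewrite (ltW t0) (ltW t1).
rewrite pE qE !poweR_EFin -EFinM /mean lee_pdivrMl // fineK //.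
have wx0 y : Q y -> 0 <= w x y by move=> Qy; exact/ltW/w0.
have wz0 y : Q y -> 0 <= w z y by move=> Qy; exact/ltW/w0.
have mx' : measurable_fun Q (fun y => ((1 - t) / p)%:E * w x y).
  by apply: emeasurable_funM => //; exact: mw.
have mz' : measurable_fun Q (fun y => (t / q)%:E * w z y).
  by apply: emeasurable_funM => //; exact: mw.
apply: (@le_trans _ _ (\int[mu]_(y in Q) ((p `^ (1 - t) * q `^ t)%:E *
     (((1 - t) / p)%:E * w x y + (t / q)%:E * w z y)))).
  apply: ge0_le_integral => //.
  - by move=> y Qy; exact/ltW/w0.
  - exact: mw.
  - by apply: emeasurable_funM => //; exact: emeasurable_funD.
  move=> y Qy; apply: le_trans (lw _ Qy _ _ _ Px Pz _) _; first by rewrite (ltW t0) (ltW t1).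
  by apply: poweR_young => //; [exact: w0|exact: w0|rewrite t0 t1].
rewrite ge0_integralZl //; last 2 first.
- exact: emeasurable_funD.
- by move=> y Qy; rewrite adde_ge0 ?mule_ge0 ?lee_fin ?wx0 ?wz0.
rewrite ge0_integralD //; last 2 first.
- by move=> y Qy; rewrite mule_ge0 ?lee_fin ?wx0.
- by move=> y Qy; rewrite mule_ge0 ?lee_fin ?wz0.
rewrite !ge0_integralZl //; [|exact: mw..].
rewrite !integral_meanE pE qE -(fineK muQf) -!(EFinM, EFinD) lee_fin.
rewrite [leRHS]mulrC ler_wpM2l // le_eqVlt; apply/orP; left; apply/eqP.
by field; rewrite !gt_eqF.
Qed.

End mean.

(** * Entropy and free energy of one system *)

Section single_system.
Local Open Scope ereal_scope.
Context (R : realType) (d : measure_display) (V : MeasNormedMod.type R d).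
Hypothesis open_meas : forall U : set V, open U -> measurable U.
Variables (P : set V) (mP : measurable P).
Variables (mu : {measure set V -> \bar R}) (muP : 0 < mu P < +oo).

Lemma Mp_measurable p v : Mp P mu p v -> measurable_fun P v.
Proof. by case=> _ lv _ _ _; exact: lsc_measurable. Qed.

Lemma Mp_ge0 p v x : Mp P mu p v -> P x -> 0 <= v x.
Proof. by case=> v0 _ _ _ _ /v0/ltW. Qed.

Lemma Mp_measurable_comp p v (g : \bar R -> \bar R) : Mp P mu p v ->
  measurable_fun setT g -> measurable_fun P (fun x => g (v x)).
Proof. by move=> Mv mg; apply: (measurableT_comp mg); exact: Mp_measurable Mv. Qed.

Lemma volumeE : volume P mu = mu P.
Proof. by rewrite /volume integral1. Qed.

(** The competitor that shows minimal energies at temperature 0 to be finite. *)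
Lemma Mp_cst1 p : (forall x y t, P x -> P y -> (0 <= t <= 1)%R ->
    P ((1 - t) *: x + t *: y)%R) -> Mp P mu p (cst 1).
Proof.
move=> cP; split => //.
- by move=> x _ a a1; exists 1%R.
- by move=> x y t _ _ _; rewrite /cst !poweR1r mule1.
- under eq_integral do rewrite /cst poweR1r.
  by rewrite integral1 //; case/andP: muP.
Qed.

Definition neg_entropy v := mean mu P (fun x => ent_dens (v x)).

Lemma neg_entropy_ge0 p v : Mp P mu p v -> 0 <= neg_entropy v.
Proof.
move=> Mv; apply: mule_ge0; first by rewrite lee_fin invr_ge0 fine_ge0.
by apply: integral_ge0 => x Px; apply: ent_dens_ge0; exact: (Mp_ge0 Mv).
Qed.

Lemma entropyE p v : Mp P mu p v -> entropy P mu v = - neg_entropy v.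
Proof.
move=> Mv; rewrite /entropy volumeE integral_xlogx //.
- by case/andP: muP.
- exact: Mp_measurable Mv.
- by move=> x; exact: (Mp_ge0 Mv).
- by case: Mv.
Qed.

(** The convention [F = +oo] at infinite negative entropy is absorbed: there [T * neg_entropy] is
    [+oo] because [T > 0], and the energy, being nonnegative, cannot offset it. *)
Lemma free_energyE s p v T : (0 < T)%R -> Mp P mu p v ->
  0 <= internal_energy P mu s v ->
  free_energy P mu s T v = internal_energy P mu s v + T%:E * neg_entropy v.
Proof.
move=> T0 Mv U0; rewrite /free_energy (entropyE Mv).
case: eqP => [/eqP|_]; last by rewrite muleN oppeK.
rewrite eqe_oppLR => /eqP ->; rewrite /= gt0_muley ?lte_fin // addey //.
by rewrite gt_eqF // (lt_le_trans (ltNyr 0)).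
Qed.

End single_system.

(** * Averaging out one variable stays within [Mp] *)

Section mean_Mp.
Local Open Scope ereal_scope.
Context (R : realType) (d : measure_display) (V : MeasNormedMod.type R d).
Hypothesis open_meas : forall U : set V, open U -> measurable U.
Variables (P : set V) (mP : measurable P).
Context d' (T : measurableType d') (mu : {measure set T -> \bar R}).
Variables (Q : set T) (mQ : measurable Q) (muQ : 0 < mu Q < +oo).
Variables (nu : {measure set V -> \bar R}) (w : V -> T -> \bar R).
Hypotheses (mw : forall x, P x -> measurable_fun Q (w x))
  (w0 : forall x y, P x -> Q y -> 0 < w x y)
  (lw : forall y, Q y -> lsc_on P (w^~ y)).

Lemma measurable_mean : measurable_fun P (fun x => mean mu Q (w x)).
Proof. by apply: lsc_measurable => //; exact: mean_lsc. Qed.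

(** The weight depends on the retained variable only. With [g] built from a marginal, this reduces
    the terms of the integrated Gibbs inequality to integrals over one factor. *)
Lemma integral_mean (g : V -> \bar R) : measurable_fun P g ->
  (forall x, P x -> 0 <= g x) ->
  \int[nu]_(x in P) \int[mu]_(y in Q) (w x y * g x) =
  mu Q * \int[nu]_(x in P) (mean mu Q (w x) * g x).
Proof.
move=> mg g0; rewrite -ge0_integralZl //; last 2 first.
- by apply: emeasurable_funM => //; exact: measurable_mean.
- move=> x Px; rewrite mule_ge0 ?g0 //; apply/ltW/mean_gt0 => // [|y Qy].
    exact: mw.
  exact: w0.
apply: eq_integral => x /[1!inE] Px /=.
under eq_integral do rewrite muleC.
rewrite ge0_integralZl //; last 3 first.
- exact: mw.
- by move=> y Qy; exact/ltW/w0.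
- exact: g0.
by rewrite (integral_meanE muQ) muleCA [g x * _]muleC.
Qed.

Lemma integral_mean1 :
  \int[nu]_(x in P) \int[mu]_(y in Q) w x y =
  mu Q * \int[nu]_(x in P) mean mu Q (w x).
Proof.
have /= := @integral_mean (cst 1) (measurable_cst _) (fun _ _ => lee01).
rewrite (_ : (fun x => mean mu Q (w x) * 1) = fun x => mean mu Q (w x)).
  move=> <-; apply: eq_integral => x _; apply: eq_integral => y _.
  by rewrite mule1.
by apply/funext => x; rewrite mule1.
Qed.

Lemma mean_Mp : (forall y, Q y -> log_convex_on P (w^~ y)) ->
  (forall x y t, P x -> P y -> (0 <= t <= 1)%R -> P ((1 - t) *: x + t *: y)%R) ->
  nu P < +oo ->
  \int[nu]_(x in P) \int[mu]_(y in Q) w x y = mu Q * nu P ->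
  Mp P nu 1 (fun x => mean mu Q (w x)).
Proof.
move=> cw cP nuP; rewrite integral_mean1 => wE.
have pm x : P x -> 0 < mean mu Q (w x).
  by move=> Px; apply: mean_gt0 => // [|y Qy]; [exact: mw|exact: w0].
have im : \int[nu]_(x in P) mean mu Q (w x) = nu P.
  have [muQ0 muQy] := andP muQ.
  have muQf : mu Q \is a fin_num by rewrite ge0_fin_numE // ltW.
  have A0 : (0 < fine (mu Q))%R by exact: fine_gt0.
  move: wE => /(congr1 (fun z => (fine (mu Q))^-1%:E * z)).
  by rewrite -(fineK muQf) !muleA -!EFinM /= !mulVf ?gt_eqF // !mul1e.
split => //.
- exact: mean_lsc.
- exact: mean_log_convex.
- by rewrite im integral1.
- rewrite (eq_integral (fun x => mean mu Q (w x))) ?im //.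
  by move=> x /[1!inE] Px; rewrite poweRe1 //; apply/ltW/pm.
Qed.

End mean_Mp.

(** * The composite system: marginals, then products *)

Section composite.
Local Open Scope ereal_scope.
Context (R : realType) (d1 d2 : measure_display)
  (V1 : MeasNormedMod.type R d1) (V2 : MeasNormedMod.type R d2).
Hypotheses (open_meas1 : forall U : set V1, open U -> measurable U)
  (open_meas2 : forall U : set V2, open U -> measurable U)
  (open_meas : forall U : set (V1 * V2)%type, open U -> measurable U).
Variables (P1 : set V1) (P2 : set V2) (clP1 : closed P1) (clP2 : closed P2).
Hypotheses
  (convP1 : forall x y t, P1 x -> P1 y -> (0 <= t <= 1)%R ->
     P1 ((1 - t) *: x + t *: y)%R)
  (convP2 : forall x y t, P2 x -> P2 y -> (0 <= t <= 1)%R ->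
     P2 ((1 - t) *: x + t *: y)%R).
Variables (m1 s1 : {finite_measure set V1 -> \bar R})
  (m2 s2 : {finite_measure set V2 -> \bar R}).
Hypotheses (m1P_gt0 : 0 < m1 P1) (m2P_gt0 : 0 < m2 P2)
  (s1b : s1 (~` boundary P1) = 0) (s2b : s2 (~` boundary P2) = 0).

Let mP1 : measurable P1.
Proof. by rewrite -[P1]setCK; apply/measurableC/open_meas1/closed_openC. Qed.

Let mP2 : measurable P2.
Proof. by rewrite -[P2]setCK; apply/measurableC/open_meas2/closed_openC. Qed.

Let m1P : 0 < m1 P1 < +oo.
Proof. by rewrite m1P_gt0 ltey_eq fin_num_measure. Qed.

Let m2P : 0 < m2 P2 < +oo.
Proof. by rewrite m2P_gt0 ltey_eq fin_num_measure. Qed.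

Let P := P1 `*` P2.
Let mu : {measure set (V1 * V2)%type -> \bar R} := m1 \x m2.

Let mP : measurable P.
Proof. exact: measurableX. Qed.

Let muE : mu P = m1 P1 * m2 P2.
Proof. exact: product_measure1E. Qed.

Let muP : 0 < mu P < +oo.
Proof.
rewrite muE mule_gt0 //= -(fineK (fin_num_measure m1 _ mP1)).
by rewrite -(fineK (fin_num_measure m2 _ mP2)) -EFinM ltry.
Qed.

(** Tonelli leaves each one-factor integral multiplied by the volume of the other factor; dividing
    by the total volume restores the normalisation of each system. *)
Let mule_sum_fine (X Y : \bar R) : 0 <= X -> 0 <= Y ->
  ((fine (mu P))^-1)%:E * (m2 P2 * X + m1 P1 * Y) =
  ((fine (m1 P1))^-1)%:E * X + ((fine (m2 P2))^-1)%:E * Y.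
Proof.
move=> X0 Y0; have [a b] := (fin_num_measure m1 _ mP1, fin_num_measure m2 _ mP2).
have a0 : (0 < fine (m1 P1))%R by exact: fine_gt0.
have b0 : (0 < fine (m2 P2))%R by exact: fine_gt0.
rewrite muE fineM // -{2}(fineK a) -{2}(fineK b).
rewrite ge0_muleDr ?mule_ge0 ?lee_fin ?(ltW a0) ?(ltW b0) //.
by rewrite !muleA -!EFinM; congr (_%:E * _ + _%:E * _); field; rewrite !gt_eqF.
Qed.

Let measurable_fun_fst (g : V1 -> \bar R) : measurable_fun P1 g ->
  measurable_fun P (fun z => g z.1).
Proof.
move=> mg; apply: (@measurable_comp _ _ _ _ _ _ P1 g) => //.
- by move=> _ [z [? ?] <-].
- exact: measurable_funTS.
Qed.

Let measurable_fun_snd (g : V2 -> \bar R) : measurable_fun P2 g ->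
  measurable_fun P (fun z => g z.2).
Proof.
move=> mg; apply: (@measurable_comp _ _ _ _ _ _ P2 g) => //.
- by move=> _ [z [? ?] <-].
- exact: measurable_funTS.
Qed.

Let integral_prod_fun (g1 : V1 -> \bar R) (g2 : V2 -> \bar R) :
  measurable_fun P1 g1 -> measurable_fun P2 g2 ->
  (forall x, P1 x -> 0 <= g1 x) -> (forall y, P2 y -> 0 <= g2 y) ->
  \int[mu]_(z in P) (g1 z.1 * g2 z.2) =
  \int[m1]_(x in P1) g1 x * \int[m2]_(y in P2) g2 y.
Proof.
move=> mg1 mg2 g10 g20; rewrite tonelli_rect1 //; last 2 first.
- by apply: emeasurable_funM; [exact: measurable_fun_fst|exact: measurable_fun_snd].
- by move=> z [? ?]; rewrite mule_ge0 ?g10 ?g20.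
rewrite [RHS]muleC -ge0_integralZl //; last exact: integral_ge0.
apply: eq_integral => x /[1!inE] P1x /=.
by rewrite ge0_integralZl ?g10 // muleC.
Qed.

Definition marg1 (v : V1 * V2 -> \bar R) x := mean m2 P2 (fun y => v (x, y)).
Definition marg2 (v : V1 * V2 -> \bar R) y := mean m1 P1 (fun x => v (x, y)).

Section marginals.
Variables (v : V1 * V2 -> \bar R) (Mv : Mp P mu 1 v).

Let mv : measurable_fun P v.
Proof. exact: (Mp_measurable open_meas mP Mv). Qed.

Let v0 z : P z -> 0 <= v z.
Proof. exact: (Mp_ge0 Mv). Qed.

Let v1 x : P1 x -> measurable_fun P2 (fun y => v (x, y)).
Proof. exact: measurable_fun_section1. Qed.

Let v2 y : P2 y -> measurable_fun P1 (fun x => v (x, y)).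
Proof. exact: measurable_fun_section2. Qed.

Let integral_v : \int[mu]_(z in P) v z = m1 P1 * m2 P2.
Proof. by case: Mv => _ _ _ -> _; rewrite integral1 // muE. Qed.

Let vp x y : P1 x -> P2 y -> 0 < v (x, y).
Proof. by case: Mv => vp _ _ _ _ P1x P2y; exact: vp. Qed.

Let lv1 y : P2 y -> lsc_on P1 (fun x => v (x, y)).
Proof.
case: Mv => _ lv _ _ _ P2y x P1x a ax.
have [e e0 He] := lv (x, y) (conj P1x P2y) a ax.
exists e => // x' P1x' xx'; apply: He => //.
by rewrite prod_normE /= subrr normr0 gt_max xx' e0.
Qed.

Let lv2 x : P1 x -> lsc_on P2 (fun y => v (x, y)).
Proof.
case: Mv => _ lv _ _ _ P1x y P2y a ay.
have [e e0 He] := lv (x, y) (conj P1x P2y) a ay.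
exists e => // y' P2y' yy'; apply: He => //.
by rewrite prod_normE /= subrr normr0 gt_max yy' e0.
Qed.

Lemma measurable_marg1 : measurable_fun P1 (marg1 v).
Proof. exact: measurable_mean. Qed.

Lemma measurable_marg2 : measurable_fun P2 (marg2 v).
Proof.
by apply: (@measurable_mean _ _ _ open_meas2 _ mP2 _ _ _ _ mP1 m1P
  (fun y x => v (x, y))) => // y x P2y P1x; exact: vp.
Qed.

Lemma marg1_Mp : Mp P1 m1 1 (marg1 v).
Proof.
apply: mean_Mp => //.
- move=> y P2y x x' t P1x P1x' t01; case: Mv => _ _ cv _ _.
  have := cv (x, y) (x', y) t (conj P1x P2y) (conj P1x' P2y) t01.
  by congr (v _ <= _); congr pair; rewrite /= -scalerDl subrK scale1r.
- by case/andP: m1P.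
- by rewrite -(tonelli_rect1 mP1 mP2 mv v0) integral_v muleC.
Qed.

Lemma marg2_Mp : Mp P2 m2 1 (marg2 v).
Proof.
apply: (@mean_Mp _ _ _ open_meas2 _ mP2 _ _ _ _ mP1 m1P _
  (fun y x => v (x, y))) => //.
- by move=> y x P2y P1x; exact: vp.
- move=> x P1x y y' t P2y P2y' t01; case: Mv => _ _ cv _ _.
  have := cv (x, y) (x, y') t (conj P1x P2y) (conj P1x P2y') t01.
  by congr (v _ <= _); congr pair; rewrite /= -scalerDl subrK scale1r.
- by case/andP: m2P.
- by rewrite -(tonelli_rect2 mP1 mP2 mv v0) integral_v.
Qed.

Let mb1 : measurable (boundary P1).
Proof.
rewrite /boundary -(closure_id P1).1 //; apply: measurableD => //.
by apply: open_meas1; exact: open_interior.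
Qed.

Let mb2 : measurable (boundary P2).
Proof.
rewrite /boundary -(closure_id P2).1 //; apply: measurableD => //.
by apply: open_meas2; exact: open_interior.
Qed.

Let bP1 : boundary P1 `<=` P1.
Proof. by rewrite /boundary -(closure_id P1).1 // => x []. Qed.

Let bP2 : boundary P2 `<=` P2.
Proof. by rewrite /boundary -(closure_id P2).1 // => x []. Qed.

Let bPE : boundary P = (boundary P1 `*` P2) `|` (P1 `*` boundary P2).
Proof.
have clP : closed P.
  rewrite (_ : P = fst @^-1` P1 `&` snd @^-1` P2); last first.
    by apply/seteqP; split => z [].
  by apply: closedI; apply: closed_comp => // -[x y] _; [exact: cvg_fst|exact: cvg_snd].
have intP x y : interior P (x, y) <-> interior P1 x /\ interior P2 y.
  split.
    move=> [[A B] [/= nA nB] AB]; split; rewrite /interior.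
      apply: filterS nA => x' Ax'.
      by have [] := AB (x', y) (conj Ax' (nbhs_singleton nB)).
    apply: filterS nB => y' By'.
    by have [] := AB (x, y') (conj (nbhs_singleton nA) By').
  by move=> [nx ny]; exists (P1, P2).
rewrite /boundary -!(closure_id _).1 //; apply/seteqP; split=> -[x y] /=.
  move=> [[P1x P2y] /intP nP].
  have [ix|ix] := pselect (interior P1 x); last by left.
  by right; split=> //; split=> // iy; apply: nP.
by move=> [[[P1x nx] P2y]|[P1x [P2y ny]]]; split=> // /intP[].
Qed.

Let mbP : measurable (boundary P).
Proof. by rewrite bPE; apply: measurableU; exact: measurableX. Qed.

Let bPP : boundary P `<=` P.
Proof. by rewrite bPE => z [[/bP1 ? ?]|[? /bP2 ?]]. Qed.

Let mvb : measurable_fun (boundary P) v.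
Proof. exact: measurable_funS mP bPP mv. Qed.

(** As [s1] is concentrated on [boundary P1], the part of the boundary outside [boundary P1 * P2] is
    null for this measure. *)
Let integral_sm : \int[s1 \x m2]_(z in boundary P) v z =
  m2 P2 * \int[s1]_(x in boundary P1) marg1 v x.
Proof.
have bsub : boundary P1 `*` P2 `<=` P by move=> z [/bP1].
rewrite (@ge0_negligible_integral _ _ _ _ _ ((~` boundary P1) `*` setT)) //.
- rewrite (_ : _ `\` _ = boundary P1 `*` P2); last first.
    apply/seteqP; split=> -[x y] /=.
      by move=> [/bPP[_ P2y] nx]; split => //; apply: contrapT => bx; apply: nx.
    by rewrite bPE => -[bx P2y]; split; [left|case].
  rewrite tonelli_rect1 //; last 2 first.
  - exact: measurable_funS mP bsub mv.
  - by move=> z /bsub; exact: v0.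
  rewrite -ge0_integralZl //; last 2 first.
  - exact: measurable_funS mP1 bP1 measurable_marg1.
  - by move=> x /bP1; exact: (Mp_ge0 marg1_Mp).
  by apply: eq_integral => x _; rewrite (integral_meanE m2P).
- by apply: measurableX => //; exact: measurableC.
- by move=> z /bPP; exact: v0.
- apply: etrans (product_measure1E _ _ (measurableC mb1) measurableT) _.
  by rewrite [X in X * _](_ : _ = 0) ?mul0e //; exact: s1b.
Qed.

Let integral_ms : \int[m1 \x s2]_(z in boundary P) v z =
  m1 P1 * \int[s2]_(y in boundary P2) marg2 v y.
Proof.
have bsub : P1 `*` boundary P2 `<=` P by move=> z [? /bP2].
rewrite (@ge0_negligible_integral _ _ _ _ _ (setT `*` (~` boundary P2))) //.
- rewrite (_ : _ `\` _ = P1 `*` boundary P2); last first.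
    apply/seteqP; split=> -[x y] /=.
      by move=> [/bPP[P1x _] ny]; split => //; apply: contrapT => bx; apply: ny.
    by rewrite bPE => -[P1x bx]; split; [right|case].
  rewrite tonelli_rect2 //; last 2 first.
  - exact: measurable_funS mP bsub mv.
  - by move=> z /bsub; exact: v0.
  rewrite -ge0_integralZl //; last 2 first.
  - exact: measurable_funS mP2 bP2 measurable_marg2.
  - by move=> x /bP2; exact: (Mp_ge0 marg2_Mp).
  by apply: eq_integral => x _; rewrite (integral_meanE m1P).
- by apply: measurableX => //; exact: measurableC.
- by move=> z /bPP; exact: v0.
- apply: etrans (product_measure1E _ _ measurableT (measurableC mb2)) _.
  by rewrite [X in _ * X](_ : _ = 0) ?mule0 //; exact: s2b.
Qed.

Lemma internal_energy_marg :
  internal_energy P mu (comp_sigma m1 s1 m2 s2) v =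
  internal_energy P1 m1 s1 (marg1 v) + internal_energy P2 m2 s2 (marg2 v).
Proof.
rewrite /internal_energy !volumeE //.
(* Recognising the bare set function as a sum of measures makes the integral additive in the
   measure. *)
rewrite (_ : comp_sigma m1 s1 m2 s2 = measure_add (s1 \x m2) (m1 \x s2)); last first.
  by apply/funext => A; rewrite measure_addE.
rewrite ge0_integral_measure_add //; last by move=> z /bPP; exact: v0.
rewrite integral_sm integral_ms mule_sum_fine // ; apply: integral_ge0.
- by move=> x /bP1; exact: (Mp_ge0 marg1_Mp).
- by move=> x /bP2; exact: (Mp_ge0 marg2_Mp).
Qed.

Let integral_v_marg1 (g : V1 -> \bar R) : measurable_fun P1 g ->
  (forall x, P1 x -> 0 <= g x) ->
  \int[mu]_(z in P) (v z * g z.1) = m2 P2 * \int[m1]_(x in P1) (marg1 v x * g x).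
Proof.
move=> mg g0; rewrite [LHS](tonelli_rect1 mP1 mP2); first last.
- by move=> z Pz; rewrite mule_ge0 ?v0 ?g0 //; case: Pz.
- by apply: emeasurable_funM => //; exact: measurable_fun_fst.
exact: (@integral_mean _ _ _ open_meas1 _ mP1 _ _ m2 _ mP2 m2P m1
  (fun x y => v (x, y)) v1 vp lv1 g mg g0).
Qed.

Let integral_v_marg2 (g : V2 -> \bar R) : measurable_fun P2 g ->
  (forall y, P2 y -> 0 <= g y) ->
  \int[mu]_(z in P) (v z * g z.2) = m1 P1 * \int[m2]_(y in P2) (marg2 v y * g y).
Proof.
move=> mg g0; rewrite [LHS](tonelli_rect2 mP1 mP2); first last.
- by move=> z Pz; rewrite mule_ge0 ?v0 ?g0 //; case: Pz.
- by apply: emeasurable_funM => //; exact: measurable_fun_snd.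
exact: (@integral_mean _ _ _ open_meas2 _ mP2 _ _ m1 _ mP1 m1P m2
  (fun y x => v (x, y)) v2 (fun y x P2y P1x => vp P1x P2y) lv2 g mg g0).
Qed.

(** In the integral of [ent_dens_superadd], with [S] the volume, the terms [v], [v] and [1]
    contribute [3 S] on the left. On the right the product of the marginals contributes [S] and the
    two [einv] terms at most [S] each. As [S] is finite, [3 S] cancels and the entropies remain. *)
Lemma neg_entropy_marg :
  neg_entropy P1 m1 (marg1 v) + neg_entropy P2 m2 (marg2 v) <= neg_entropy P mu v.
Proof.
have M1 := marg1_Mp; have M2 := marg2_Mp.
set f1 := marg1 v in M1 *; set f2 := marg2 v in M2 *.
have f10 x : P1 x -> 0 < f1 x by case: M1 => + _ _ _ _; apply.
have f20 y : P2 y -> 0 < f2 y by case: M2 => + _ _ _ _; apply.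
have mc1 (g : \bar R -> \bar R) : measurable_fun setT g -> measurable_fun P1 (fun x => g (f1 x)).
  by move=> mg; exact: (Mp_measurable_comp open_meas1 mP1 M1 mg).
have mc2 (g : \bar R -> \bar R) : measurable_fun setT g -> measurable_fun P2 (fun y => g (f2 y)).
  by move=> mg; exact: (Mp_measurable_comp open_meas2 mP2 M2 mg).
have mk1 := mc1 _ (@measurable_ent_rate R); have mi1 := mc1 _ (@measurable_einv R).
have mk2 := mc2 _ (@measurable_ent_rate R); have mi2 := mc2 _ (@measurable_einv R).
have k10 x : P1 x -> 0 <= ent_rate (f1 x) by move=> /f10/ent_rate_ge0.
have k20 y : P2 y -> 0 <= ent_rate (f2 y) by move=> /f20/ent_rate_ge0.
have i10 x : P1 x -> 0 <= einv (f1 x) by move=> /f10/ltW/einv_ge0.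
have i20 y : P2 y -> 0 <= einv (f2 y) by move=> /f20/ltW/einv_ge0.
have mf1 := Mp_measurable open_meas1 mP1 M1; have mf2 := Mp_measurable open_meas2 mP2 M2.
set S := m1 P1 * m2 P2.
have Sf : S \is a fin_num by rewrite /S -muE ge0_fin_numE //; case/andP: muP.
have me : measurable_fun P (fun z => ent_dens (v z)).
  exact: (Mp_measurable_comp open_meas mP Mv (@measurable_ent_dens R)).
have e0 z : P z -> 0 <= ent_dens (v z) by move=> /v0/ent_dens_ge0.
have mA : measurable_fun P (fun z => v z * ent_rate (f1 z.1)) :=
  emeasurable_funM mv (measurable_fun_fst mk1).
have mB : measurable_fun P (fun z => v z * ent_rate (f2 z.2)) :=
  emeasurable_funM mv (measurable_fun_snd mk2).
have mC : measurable_fun P (fun z => v z * einv (f1 z.1)) :=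
  emeasurable_funM mv (measurable_fun_fst mi1).
have mD : measurable_fun P (fun z => v z * einv (f2 z.2)) :=
  emeasurable_funM mv (measurable_fun_snd mi2).
have mE : measurable_fun P (fun z => f1 z.1 * f2 z.2) :=
  emeasurable_funM (measurable_fun_fst mf1) (measurable_fun_snd mf2).
have A0 z : P z -> 0 <= v z * ent_rate (f1 z.1).
  by move=> Pz; rewrite mule_ge0 ?v0 ?k10 //; case: Pz.
have B0 z : P z -> 0 <= v z * ent_rate (f2 z.2).
  by move=> Pz; rewrite mule_ge0 ?v0 ?k20 //; case: Pz.
have C0 z : P z -> 0 <= v z * einv (f1 z.1).
  by move=> Pz; rewrite mule_ge0 ?v0 ?i10 //; case: Pz.
have D0 z : P z -> 0 <= v z * einv (f2 z.2).
  by move=> Pz; rewrite mule_ge0 ?v0 ?i20 //; case: Pz.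
have E0 z : P z -> 0 <= f1 z.1 * f2 z.2.
  by move=> [/f10/ltW ? /f20/ltW ?]; exact: mule_ge0.
have m3 := emeasurable_funD mA mB; have m4 := emeasurable_funD m3 mv.
have m4' := emeasurable_funD m4 mv.
have m5 := emeasurable_funD me mE; have m6 := emeasurable_funD m5 mC.
have p3 z (Pz : P z) := adde_ge0 (A0 z Pz) (B0 z Pz).
have p4 z (Pz : P z) := adde_ge0 (p3 z Pz) (v0 Pz).
have p4' z (Pz : P z) := adde_ge0 (p4 z Pz) (v0 Pz).
have p5 z (Pz : P z) := adde_ge0 (e0 z Pz) (E0 z Pz).
have p6 z (Pz : P z) := adde_ge0 (p5 z Pz) (C0 z Pz).
have p01 (z : (V1 * V2)%type) : P z -> 0 <= 1 :> \bar R by [].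
have m1' : measurable_fun P (cst (1 : \bar R)) by exact: measurable_cst.
have : \int[mu]_(z in P) (v z * ent_rate (f1 z.1) + v z * ent_rate (f2 z.2) +
    v z + v z + 1) <=
  \int[mu]_(z in P) (ent_dens (v z) + f1 z.1 * f2 z.2 + v z * einv (f1 z.1) +
    v z * einv (f2 z.2)).
  apply: (ge0_le_integral mu mP (fun z Pz => adde_ge0 (p4' z Pz) lee01)
    (emeasurable_funD m4' m1') (emeasurable_funD m6 mD)) => z Pz.
  by apply: ent_dens_superadd; [exact: v0|apply: f10; case: Pz|apply: f20; case: Pz].
rewrite (ge0_integralD mu mP p4' m4' p01 m1').
rewrite (ge0_integralD mu mP p4 m4 v0 mv) (ge0_integralD mu mP p3 m3 v0 mv).
rewrite (ge0_integralD mu mP A0 mA B0 mB).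
rewrite (ge0_integralD mu mP p6 m6 D0 mD) (ge0_integralD mu mP p5 m5 C0 mC).
rewrite (ge0_integralD mu mP e0 me E0 mE).
have AE : \int[mu]_(z in P) (v z * ent_rate (f1 z.1)) =
    m2 P2 * \int[m1]_(x in P1) (f1 x * ent_rate (f1 x)).
  exact: (integral_v_marg1 mk1 k10).
have BE : \int[mu]_(z in P) (v z * ent_rate (f2 z.2)) =
    m1 P1 * \int[m2]_(y in P2) (f2 y * ent_rate (f2 y)).
  exact: (integral_v_marg2 mk2 k20).
have CE : \int[mu]_(z in P) (v z * einv (f1 z.1)) =
    m2 P2 * \int[m1]_(x in P1) (f1 x * einv (f1 x)).
  exact: (integral_v_marg1 mi1 i10).
have DE : \int[mu]_(z in P) (v z * einv (f2 z.2)) =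
    m1 P1 * \int[m2]_(y in P2) (f2 y * einv (f2 y)).
  exact: (integral_v_marg2 mi2 i20).
have EE : \int[mu]_(z in P) (f1 z.1 * f2 z.2) =
    \int[m1]_(x in P1) f1 x * \int[m2]_(y in P2) f2 y.
  exact: (integral_prod_fun mf1 mf2 (fun x P1x => ltW (f10 x P1x))
    (fun y P2y => ltW (f20 y P2y))).
rewrite [X in X + _ + _ + _ + _ <= _]AE [X in _ + X + _ + _ + _ <= _]BE.
rewrite [X in _ <= _ + _ + X + _]CE [X in _ <= _ + _ + _ + X]DE.
rewrite [X in _ <= _ + X + _ + _]EE [X in _ + _ + X + _ + _ <= _]integral_v.
rewrite [X in _ + _ + _ + X + _ <= _]integral_v.
rewrite [X in _ + _ + _ + _ + X <= _](integral1 mu mP) [X in _ + X <= _]muE.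
rewrite (_ : \int[m1]_(x in P1) f1 x = m1 P1); last first.
  by case: M1 => _ _ _ -> _; rewrite integral1.
rewrite (_ : \int[m2]_(x in P2) f2 x = m2 P2); last first.
  by case: M2 => _ _ _ -> _; rewrite integral1.
rewrite -/S.
set X := \int[m1]_(x in P1) (f1 x * ent_rate _).
set Y := \int[m2]_(x in P2) (f2 x * ent_rate _).
have XE : X = \int[m1]_(x in P1) ent_dens (f1 x).
  apply: eq_integral => x /[1!inE] P1x; rewrite muleC ent_rate_mul //; exact: f10.
have YE : Y = \int[m2]_(x in P2) ent_dens (f2 x).
  apply: eq_integral => x /[1!inE] P2x; rewrite muleC ent_rate_mul //; exact: f20.
set I1 := \int[m1]_(x in P1) (f1 x * einv _).
set I2 := \int[m2]_(x in P2) (f2 x * einv _).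
have I1S : m2 P2 * I1 <= S.
  rewrite /S muleC; apply: lee_wpmul2r => //; rewrite -(integral1 m1 mP1).
  apply: ge0_le_integral => //.
  - by move=> x P1x; rewrite mule_ge0 ?i10 //; exact/ltW/f10.
  - exact: emeasurable_funM.
  - by move=> x P1x; rewrite muleC; exact/einv_mul_le1/ltW/f10.
have I2S : m1 P1 * I2 <= S.
  rewrite /S; apply: lee_wpmul2l => //; rewrite -(integral1 m2 mP2).
  apply: ge0_le_integral => //.
  - by move=> x P2x; rewrite mule_ge0 ?i20 //; exact/ltW/f20.
  - exact: emeasurable_funM.
  - by move=> x P2x; rewrite muleC; exact/einv_mul_le1/ltW/f20.
set Z := \int[mu]_(z in P) ent_dens _ => h.
have {}h : m2 P2 * X + m1 P1 * Y + S + S + S <= Z + S + S + S.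
  by apply: le_trans h _; rewrite leeD // leeD.
rewrite !leeD2rE // in h.
rewrite /neg_entropy /mean -XE -YE -mule_sum_fine; last 2 first.
- by apply: integral_ge0 => x P1x; rewrite mule_ge0 ?k10 //; exact/ltW/f10.
- by apply: integral_ge0 => x P2x; rewrite mule_ge0 ?k20 //; exact/ltW/f20.
by apply: lee_wpmul2l => //; rewrite lee_fin invr_ge0 fine_ge0.
Qed.

End marginals.
Section product.
Variables (u1 : V1 -> \bar R) (u2 : V2 -> \bar R).
Hypotheses (Mu1 : Mp P1 m1 1 u1) (Mu2 : Mp P2 m2 1 u2).
Let u := prod_fun u1 u2.

Let u10 x : P1 x -> 0 < u1 x. Proof. by case: Mu1 => + _ _ _ _; apply. Qed.
Let u20 y : P2 y -> 0 < u2 y. Proof. by case: Mu2 => + _ _ _ _; apply. Qed.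

Let mu1 : measurable_fun P1 u1.
Proof. exact: (Mp_measurable open_meas1 mP1 Mu1). Qed.

Let mu2 : measurable_fun P2 u2.
Proof. exact: (Mp_measurable open_meas2 mP2 Mu2). Qed.

Let iu1 : \int[m1]_(x in P1) u1 x = m1 P1.
Proof. by case: Mu1 => _ _ _ -> _; rewrite integral1. Qed.

Let iu2 : \int[m2]_(x in P2) u2 x = m2 P2.
Proof. by case: Mu2 => _ _ _ -> _; rewrite integral1. Qed.

Lemma marg1_prod x : P1 x -> marg1 u x = u1 x.
Proof.
move=> P1x; rewrite /marg1 /mean /u /prod_fun /=.
rewrite ge0_integralZl //; [|by move=> y /u20/ltW|exact/ltW/u10].
rewrite iu2 muleCA -{2}(fineK (fin_num_measure m2 _ mP2)) -EFinM mulVf ?mule1 //.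
by rewrite gt_eqF // fine_gt0.
Qed.

Lemma marg2_prod y : P2 y -> marg2 u y = u2 y.
Proof.
move=> P2y; rewrite /marg2 /mean /u /prod_fun /=.
under eq_integral do rewrite muleC.
rewrite ge0_integralZl //; [|by move=> x /u10/ltW|exact/ltW/u20].
rewrite iu1 muleCA -{2}(fineK (fin_num_measure m1 _ mP1)) -EFinM mulVf ?mule1 //.
by rewrite gt_eqF // fine_gt0.
Qed.

Let lsc_prod : lsc_on P u.
Proof.
move=> [x y] [/= P1x P2y] a; rewrite /u /prod_fun /= => au.
have ux := u10 P1x; have uy := u20 P2y.
have [a0|a0] := leP a 0%R.
  exists 1%R => // -[x' y'] [/u10 /= ux' /u20 uy'] _.
  by apply: (@le_lt_trans _ _ 0); [rewrite lee_fin|exact: mule_gt0].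
(* Splits [a] as [b * (a / b)] with each factor strictly below its own function value: [b] must lie
   below [u1 x] and above [a / u2 y], and its choice depends on which values are infinite. *)
have [b [b0 bx ab]] : exists b : R, [/\ (0 < b)%R, b%:E < u1 x & (a / b)%:E < u2 y].
  move: ux uy au; case: (u1 x) => [r| |] //; case: (u2 y) => [q| |] //.
  - rewrite -EFinM !lte_fin => r0 q0 arq; exists ((a / q + r) / 2)%R.
    have aq : (a / q < r)%R by rewrite ltr_pdivrMr.
    have aq0 : (0 < a / q)%R by rewrite divr_gt0.
    split; rewrite ?lte_fin.
    - by rewrite divr_gt0 // addr_gt0.
    - by rewrite midf_lt.
    - rewrite ltr_pdivrMr ?divr_gt0 ?addr_gt0 // mulrC -ltr_pdivrMr //.
      by rewrite midf_lt.
  - move=> r0 _ _; exists (r / 2)%R; rewrite lte_fin in r0.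
    by split; rewrite ?lte_fin ?ltry // ?divr_gt0 // ltr_pdivrMr // mulr_natr mulr2n ltrDr.
  - move=> _ q0 _; exists (a / q + 1)%R; rewrite lte_fin in q0.
    have aq0 : (0 < a / q)%R by rewrite divr_gt0.
    have b0 : (0 < a / q + 1)%R by rewrite addr_gt0.
    split; rewrite ?lte_fin ?ltry // ltr_pdivrMr // mulrDr mulrCA divff ?gt_eqF //.
    by rewrite !mulr1 ltrDl.
  - by move=> _ _ _; exists 1%R; rewrite !ltry.
case: Mu1 => _ l1 _ _ _; case: Mu2 => _ l2 _ _ _.
have [e e0 He] := l1 _ P1x _ bx; have [f f0 Hf] := l2 _ P2y _ ab.
exists (Num.min e f); first by rewrite lt_min e0.
move=> [x' y'] [/= P1x' P2y']; rewrite prod_normE /= gt_max !lt_min.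
move=> /andP[/andP[xe _] /andP[_ yf]].
have -> : a%:E = b%:E * (a / b)%:E by rewrite -EFinM mulrC divfK ?gt_eqF.
by apply: lte_pmul; rewrite ?lee_fin ?ltW ?divr_gt0 //; [exact: He|exact: Hf].
Qed.

Lemma prod_Mp : Mp P mu 1 u.
Proof.
have up z : P z -> 0 < u z by case: z => x y [/u10 ? /u20 ?]; exact: mule_gt0.
have iu : \int[mu]_(z in P) u z = m1 P1 * m2 P2.
  have := integral_prod_fun mu1 mu2 (fun x P1x => ltW (u10 P1x)) (fun y P2y => ltW (u20 P2y)).
  by rewrite [X in _ = X * _]iu1 [X in _ = _ * X]iu2.
split.
- exact: up.
- exact: lsc_prod.
- move=> [x y] [x' y'] t [/= P1x P2y] [/= P1x' P2y'] t01.
  case: Mu1 => _ _ c1 _ _; case: Mu2 => _ _ c2 _ _.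
  rewrite /u /prod_fun /=.
  rewrite !poweRM ?(ltW (u10 P1x), ltW (u10 P1x'), ltW (u20 P2y), ltW (u20 P2y')) //.
  rewrite muleACA; apply: lee_pmul.
  - by apply/ltW/u10/convP1.
  - by apply/ltW/u20/convP2.
  - exact: c1.
  - exact: c2.
- by rewrite (integral1 mu mP) muE iu.
- rewrite (eq_integral u); last first.
    by move=> z /[1!inE] Pz; rewrite poweRe1 //; exact/ltW/up.
  by rewrite [X in X < _]iu -muE; case/andP: muP.
Qed.

Lemma internal_energy_prod :
  internal_energy P mu (comp_sigma m1 s1 m2 s2) u =
  internal_energy P1 m1 s1 u1 + internal_energy P2 m2 s2 u2.
Proof.
rewrite (internal_energy_marg prod_Mp) /internal_energy; congr (_ * _ + _ * _).
- apply: eq_integral => x /[1!inE] bx; apply: marg1_prod.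
  by move: bx; rewrite /boundary -(closure_id P1).1 // => -[].
- apply: eq_integral => y /[1!inE] by_; apply: marg2_prod.
  by move: by_; rewrite /boundary -(closure_id P2).1 // => -[].
Qed.

(** In the integral of [ent_densM], the functions [u1], [u2], [u1 * u2] and [1] all integrate to the
    volume, so two finite copies of it cancel on each side. *)
Lemma neg_entropy_prod :
  neg_entropy P mu u = neg_entropy P1 m1 u1 + neg_entropy P2 m2 u2.
Proof.
have [a0 b0] : (forall x, P1 x -> 0 <= u1 x) /\ (forall y, P2 y -> 0 <= u2 y).
  by split=> [x /u10/ltW|y /u20/ltW].
have e1 x : P1 x -> 0 <= ent_dens (u1 x) by move=> /a0/ent_dens_ge0.
have e2 y : P2 y -> 0 <= ent_dens (u2 y) by move=> /b0/ent_dens_ge0.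
have me1 : measurable_fun P1 (fun x => ent_dens (u1 x)).
  exact: (Mp_measurable_comp open_meas1 mP1 Mu1 (@measurable_ent_dens R)).
have me2 : measurable_fun P2 (fun x => ent_dens (u2 x)).
  exact: (Mp_measurable_comp open_meas2 mP2 Mu2 (@measurable_ent_dens R)).
have me : measurable_fun P (fun z => ent_dens (u1 z.1 * u2 z.2)).
  exact: (Mp_measurable_comp open_meas mP prod_Mp (@measurable_ent_dens R)).
have ma := measurable_fun_fst mu1; have mb := measurable_fun_snd mu2.
have mA : measurable_fun P (fun z => ent_dens (u1 z.1) * u2 z.2) :=
  emeasurable_funM (measurable_fun_fst me1) mb.
have mB : measurable_fun P (fun z => u1 z.1 * ent_dens (u2 z.2)) :=
  emeasurable_funM ma (measurable_fun_snd me2).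
have mC : measurable_fun P (fun z => u1 z.1 * u2 z.2) := emeasurable_funM ma mb.
have e0 z : P z -> 0 <= ent_dens (u1 z.1 * u2 z.2).
  by move=> [? ?]; apply/ent_dens_ge0/mule_ge0; [exact: a0|exact: b0].
have a0' z : P z -> 0 <= u1 z.1 by move=> [? ?]; exact: a0.
have b0' z : P z -> 0 <= u2 z.2 by move=> [? ?]; exact: b0.
have A0 z : P z -> 0 <= ent_dens (u1 z.1) * u2 z.2.
  by move=> [? ?]; apply: mule_ge0; [exact: e1|exact: b0].
have B0 z : P z -> 0 <= u1 z.1 * ent_dens (u2 z.2).
  by move=> [? ?]; apply: mule_ge0; [exact: a0|exact: e2].
have C0 z : P z -> 0 <= u1 z.1 * u2 z.2.
  by move=> [? ?]; apply: mule_ge0; [exact: a0|exact: b0].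
have m1' : measurable_fun P (cst (1 : \bar R)) by exact: measurable_cst.
have p01 (z : (V1 * V2)%type) : P z -> 0 <= 1 :> \bar R by [].
have p1 z (Pz : P z) := adde_ge0 (e0 z Pz) (a0' z Pz).
have p2 z (Pz : P z) := adde_ge0 (A0 z Pz) (B0 z Pz).
have p3 z (Pz : P z) := adde_ge0 (p2 z Pz) (C0 z Pz).
have : \int[mu]_(z in P) (ent_dens (u1 z.1 * u2 z.2) + u1 z.1 + u2 z.2) =
  \int[mu]_(z in P) (ent_dens (u1 z.1) * u2 z.2 + u1 z.1 * ent_dens (u2 z.2) +
     u1 z.1 * u2 z.2 + 1).
  apply: eq_integral => z /[1!inE] -[? ?].
  by rewrite ent_densM ?u10 ?u20 // [u2 _ * _]muleC.
rewrite (ge0_integralD mu mP p1 (emeasurable_funD me ma) b0' mb).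
rewrite (ge0_integralD mu mP e0 me a0' ma).
rewrite (ge0_integralD mu mP p3 (emeasurable_funD (emeasurable_funD mA mB) mC) p01 m1').
rewrite (ge0_integralD mu mP p2 (emeasurable_funD mA mB) C0 mC).
rewrite (ge0_integralD mu mP A0 mA B0 mB).
have AE : \int[mu]_(z in P) (ent_dens (u1 z.1) * u2 z.2) =
    \int[m1]_(x in P1) ent_dens (u1 x) * \int[m2]_(y in P2) u2 y.
  exact: (integral_prod_fun me1 mu2 e1 b0).
have BE : \int[mu]_(z in P) (u1 z.1 * ent_dens (u2 z.2)) =
    \int[m1]_(x in P1) u1 x * \int[m2]_(y in P2) ent_dens (u2 y).
  exact: (integral_prod_fun mu1 me2 a0 e2).
have CE : \int[mu]_(z in P) (u1 z.1 * u2 z.2) =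
    \int[m1]_(x in P1) u1 x * \int[m2]_(y in P2) u2 y.
  exact: (integral_prod_fun mu1 mu2 a0 b0).
(* The constant 1 serves as the missing factor when a function of one variable is integrated over
   the product. *)
have c1E : \int[m1]_(x in P1) cst (1 : \bar R) x = m1 P1 by exact: integral1.
have c2E : \int[m2]_(x in P2) cst (1 : \bar R) x = m2 P2 by exact: integral1.
have aE : \int[mu]_(z in P) u1 z.1 = m1 P1 * m2 P2.
  rewrite -[in X in X * _]iu1 -[in X in _ * X]c2E.
  rewrite -(integral_prod_fun mu1 (measurable_cst _) a0) //.
  by apply: eq_integral => z _; rewrite mule1.
have bE : \int[mu]_(z in P) u2 z.2 = m1 P1 * m2 P2.
  rewrite -[in X in X * _]c1E -[in X in _ * X]iu2.
  rewrite -(integral_prod_fun (measurable_cst _) mu2 _ b0) //.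
  by apply: eq_integral => z _; rewrite mul1e.
rewrite [X in _ + X + _ = _]aE [X in _ + X = _]bE.
rewrite [X in _ = X + _ + _ + _]AE [X in _ = _ + X + _ + _]BE.
rewrite [X in _ = _ + _ + X + _]CE [X in _ = _ + X](integral1 mu mP).
rewrite iu1 iu2 [X in _ = _ + X]muE.
set S := m1 P1 * m2 P2.
have Sf : S \is a fin_num by rewrite /S -muE ge0_fin_numE //; case/andP: muP.
set Z := \int[mu]_(z in P) _; set X := \int[m1]_(x in P1) _.
set Y := \int[m2]_(y in P2) _ => h.
have {}h : Z = m2 P2 * X + m1 P1 * Y.
  move: h => /(congr1 (fun z => z - S - S)); rewrite !addeK //.
  by rewrite [X * _]muleC.
rewrite /neg_entropy /mean -/X -/Y -mule_sum_fine -?h //; apply: integral_ge0.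
- exact: e1.
- exact: e2.
Qed.

End product.
End composite.

(** * Sign and finiteness of the energy *)

Section internal_energy.
Local Open Scope ereal_scope.
Context (R : realType) (d : measure_display) (V : MeasNormedMod.type R d).
Hypothesis open_meas : forall U : set V, open U -> measurable U.
Variables (P : set V) (clP : closed P) (mP : measurable P).
Variables (m s : {finite_measure set V -> \bar R}).

Lemma internal_energy_ge0 p v : Mp P m p v -> 0 <= internal_energy P m s v.
Proof.
move=> Mv; apply: mule_ge0.
  by rewrite volumeE // lee_fin invr_ge0 fine_ge0.
apply: integral_ge0 => x; rewrite /boundary -(closure_id P).1 // => -[Px _].
exact: (Mp_ge0 Mv).
Qed.

Lemma internal_energy_cst1_lty : internal_energy P m s (cst 1) < +oo.
Proof.
have mb : measurable (boundary P).
  rewrite /boundary -(closure_id P).1 //; apply: measurableD => //.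
  by apply: open_meas; exact: open_interior.
rewrite /internal_energy integral_cst // mul1e.
apply: lte_mul_pinfty => //; last by rewrite ltey_eq fin_num_measure.
by rewrite volumeE // lee_fin invr_ge0 fine_ge0.
Qed.

End internal_energy.

(** * Comparison with an arbitrary competitor through its marginals *)

Theorem mainTheorem17 (R : realType) (d1 d2 : measure_display)
  (V1 : MeasNormedMod.type R d1) (V2 : MeasNormedMod.type R d2)
  (n1 n2 : nat) (P1 : set V1) (P2 : set V2)
  (dmu1 dsigma1 : set V1 -> \bar R) (dmu2 dsigma2 : set V2 -> \bar R)
  (T : R) (u1 : V1 -> \bar R) (u2 : V2 -> \bar R) :
  is_system n1 P1 dmu1 dsigma1 ->
  is_system n2 P2 dmu2 dsigma2 ->
  0 <= T ->
  canonical_distribution P1 dmu1 dsigma1 T u1 ->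
  canonical_distribution P2 dmu2 dsigma2 T u2 ->
  canonical_distribution (P1 `*` P2) (comp_mu dmu1 dmu2)
    (comp_sigma dmu1 dsigma1 dmu2 dsigma2) T (prod_fun u1 u2).
Proof.
move=> sys1 sys2 _ [Mu1 can1] [Mu2 can2].
have o1 := is_system_open_measurable sys1.
have o2 := is_system_open_measurable sys2.
have [PP1 PP2] : polytope P1 /\ polytope P2.
  by case: sys1 => _ _ [? _] _ _; case: sys2 => _ _ [? _] _ _.
have o12 : forall U : set (V1 * V2)%type, open U -> measurable U.
  apply: open_measurable_prod => //.
    by case: sys1 => /has_dim_countably_dense.
  by case: sys2 => /has_dim_countably_dense.
have cl1 := polytope_closed PP1; have cl2 := polytope_closed PP2.
have cv1 x y t Px Py := @polytope_conv _ _ P1 x y t PP1 Px Py.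
have cv2 x y t Px Py := @polytope_conv _ _ P2 x y t PP2 Px Py.
have mP1 : measurable P1 by rewrite -[P1]setCK; apply/measurableC/o1/closed_openC.
have mP2 : measurable P2 by rewrite -[P2]setCK; apply/measurableC/o2/closed_openC.
have [m1 [s1 [dm1 ds1 m1P s1b]]] := is_system_measures sys1.
have [m2 [s2 [dm2 ds2 m2P s2b]]] := is_system_measures sys2.
subst dmu1 dsigma1 dmu2 dsigma2.
have m1Py : (0 < m1 P1 < +oo)%E by rewrite m1P ltey_eq fin_num_measure.
have m2Py : (0 < m2 P2 < +oo)%E by rewrite m2P ltey_eq fin_num_measure.
set P := P1 `*` P2; set u := prod_fun u1 u2; set sigma := comp_sigma _ _ _ _.
pose mu : {measure set (V1 * V2)%type -> \bar R} := (m1 \x m2)%E.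
(* [comp_mu] unfolds to the product measure, now with its measure structure visible. *)
change (canonical_distribution P mu sigma T u).
have mP : measurable P by exact: measurableX.
have muP : (0 < mu P < +oo)%E.
  rewrite (_ : mu P = m1 P1 * m2 P2)%E; last exact: product_measure1E.
  rewrite mule_gt0 //= -(fineK (fin_num_measure m1 _ mP1)).
  by rewrite -(fineK (fin_num_measure m2 _ mP2)) -EFinM ltry.
have Mu : Mp P mu 1 u by exact: prod_Mp.
have Uu : internal_energy P mu sigma u =
    (internal_energy P1 m1 s1 u1 + internal_energy P2 m2 s2 u2)%E.
  exact: internal_energy_prod.
have Hu : neg_entropy P mu u = (neg_entropy P1 m1 u1 + neg_entropy P2 m2 u2)%E.
  exact: neg_entropy_prod.
have Uv v : Mp P mu 1 v -> internal_energy P mu sigma v =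
    (internal_energy P1 m1 s1 (marg1 P2 m2 v) +
     internal_energy P2 m2 s2 (marg2 P1 m1 v))%E.
  by move=> Mv; exact: internal_energy_marg.
have Hv v : Mp P mu 1 v -> (neg_entropy P1 m1 (marg1 P2 m2 v) +
    neg_entropy P2 m2 (marg2 P1 m1 v) <= neg_entropy P mu v)%E.
  by move=> Mv; exact: neg_entropy_marg.
have M1 v : Mp P mu 1 v -> Mp P1 m1 1 (marg1 P2 m2 v).
  by move=> Mv; exact: marg1_Mp.
have M2 v : Mp P mu 1 v -> Mp P2 m2 1 (marg2 P1 m1 v).
  by move=> Mv; exact: marg2_Mp.
have U10 v : Mp P1 m1 1 v -> (0 <= internal_energy P1 m1 s1 v)%E.
  exact: internal_energy_ge0.
have U20 v : Mp P2 m2 1 v -> (0 <= internal_energy P2 m2 s2 v)%E.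
  exact: internal_energy_ge0.
have H10 v : Mp P1 m1 1 v -> (0 <= neg_entropy P1 m1 v)%E.
  exact: neg_entropy_ge0.
have H20 v : Mp P2 m2 1 v -> (0 <= neg_entropy P2 m2 v)%E.
  exact: neg_entropy_ge0.
have U0 v : Mp P mu 1 v -> (0 <= internal_energy P mu sigma v)%E.
  by move=> Mv; rewrite (Uv _ Mv); apply: adde_ge0; [exact/U10/M1|exact/U20/M2].
split=> //; case: can1 => [[T0 min1]|[T0 [min1 ent1]]].
  case: can2 => [[_ min2]|[T0']]; last by rewrite T0' ltxx in T0.
  left; split=> // v Mv.
  have F1 w (Mw : Mp P1 m1 1 w) := free_energyE o1 mP1 m1Py T0 Mw (U10 _ Mw).
  have F2 w (Mw : Mp P2 m2 1 w) := free_energyE o2 mP2 m2Py T0 Mw (U20 _ Mw).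
  have F w (Mw : Mp P mu 1 w) := free_energyE o12 mP muP T0 Mw (U0 _ Mw).
  have M1v := M1 _ Mv; have M2v := M2 _ Mv.
  rewrite (F _ Mu) (F _ Mv) Uu Hu (Uv _ Mv).
  (* Distributing [T] is legitimate because both negative entropies are nonnegative; the sum then
     regroups into the two free energies. *)
  rewrite (ge0_muleDr _ (H10 _ Mu1) (H20 _ Mu2)) addeACA -(F1 _ Mu1) -(F2 _ Mu2).
  apply: le_trans (leeD (min1 _ M1v) (min2 _ M2v)) _.
  rewrite (F1 _ M1v) (F2 _ M2v) addeACA -(ge0_muleDr _ (H10 _ M1v) (H20 _ M2v)).
  by apply: leeD => //; apply: lee_wpmul2l; [rewrite lee_fin ltW|exact: Hv].
case: can2 => [[]|[_ [min2 ent2]]]; first by rewrite T0 ltxx.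
right; split=> //; split=> [v Mv|v Mv minv].
  by rewrite Uu Uv //; apply: leeD; [exact: min1 (M1 _ Mv)|exact: min2 (M2 _ Mv)].
have fin1 : internal_energy P1 m1 s1 u1 \is a fin_num.
  rewrite ge0_fin_numE ?U10 //.
  apply: le_lt_trans (min1 _ (Mp_cst1 mP1 m1Py 1 cv1)) _.
  exact: internal_energy_cst1_lty.
have fin2 : internal_energy P2 m2 s2 u2 \is a fin_num.
  rewrite ge0_fin_numE ?U20 //.
  apply: le_lt_trans (min2 _ (Mp_cst1 mP2 m2Py 1 cv2)) _.
  exact: internal_energy_cst1_lty.
have le12 := minv _ Mu; rewrite Uu Uv // in le12.
(* The sum of the marginal energies is at most the sum of the two minima, and the second marginal is
   at least its minimum, which is finite and cancels. Hence the first marginal is a minimiser too,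
   and maximality of entropy among minimisers applies to it. *)
have opt1 : (internal_energy P1 m1 s1 (marg1 P2 m2 v) <= internal_energy P1 m1 s1 u1)%E.
  rewrite -(leeD2rE _ _ fin2); apply: le_trans le12; apply: leeD2l.
  exact: min2 (M2 _ Mv).
have opt2 : (internal_energy P2 m2 s2 (marg2 P1 m1 v) <= internal_energy P2 m2 s2 u2)%E.
  rewrite -(leeD2lE _ _ fin1); apply: le_trans le12; apply: leeD2r.
  exact: min1 (M1 _ Mv).
have := ent1 _ (M1 _ Mv) (fun w Mw => le_trans opt1 (min1 w Mw)).
have := ent2 _ (M2 _ Mv) (fun w Mw => le_trans opt2 (min2 w Mw)).
rewrite (entropyE o1 mP1 m1Py Mu1) (entropyE o1 mP1 m1Py (M1 _ Mv)).
rewrite (entropyE o2 mP2 m2Py Mu2) (entropyE o2 mP2 m2Py (M2 _ Mv)).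
rewrite (entropyE o12 mP muP Mu) (entropyE o12 mP muP Mv) !leeN2 => h2 h1.
by rewrite Hu; apply: le_trans (leeD h1 h2) (Hv _ Mv).
Qed.
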